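(* Let $P$ be a probability measure on $\mathbb{R}^d$ with strictly positive Lebesgue density $p$, let $\hat Q$ be a random proposal with density $\hat q$, let $X_1,\dots,X_n$ be conditionally i.i.d. from $\hat Q$ given $\hat Q$, and let $Z\sim P$, all as specified in the context. Let $f\in L^2(P)$ and let $$\mathcal{I}(f)=\int_{\mathbb{R}^d} f\,p\,\mathrm{d}x,\qquad \mathcal{I}_n(f)=\frac1n\sum_{i=1}^n \hat\rho(X_i)f(X_i),\qquad \hat\rho=\frac{p}{\hat q}.$$ Then: (a) (Unbiasedness) $\mathbb{E}[\mathcal{I}_n(f)\mid \hat Q]=\mathcal{I}(f)$ almost surely. In particular, $\mathbb{E}[\mathcal{I}_n(f)]=\mathcal{I}(f)$. (b) (Variance bound) $$\operatorname{Var}[\mathcal{I}_n(f)]\le \frac1n\left(\operatorname{Var}[f(Z)]+\int_{\mathbb{R}^d}\mathbb{E}\bigl[|\hat\rho(x)-1|\bigr]\,f(x)^2\,p(x)\,\mathrm{d}x\right).$$ (c) (Non-asymptotic error bound) $$\mathbb{E}\bigl[|\mathcal{I}_n(f)-\mathcal{I}(f)|\bigr]\le \frac{\|f\|_{L^2(P)}}{\sqrt n}\Bigl(1+\bigl(4n\,\mathrm{MIAE}(\hat q)\bigr)^{1/3}\Bigr)^{3/2}=\mathcal{O}\bigl(n^{-1/2}+\mathrm{MIAE}(\hat q)^{1/2}\bigr).$$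
   Context: Setting. $(\Omega,\Sigma,\mathbb{P})$ is a probability space. $\mathcal{P}(\mathbb{R}^d)$ is the space of Borel probability measures on $\mathbb{R}^d$, with the Borel $\sigma$-algebra of the weak topology (generated by the evaluation maps $\mu\mapsto\mu(B)$, $B$ Borel). $P\in\mathcal{P}(\mathbb{R}^d)$ has strictly positive Lebesgue density $p:\mathbb{R}^d\to(0,\infty)$. $\hat Q$ is a $\mathcal{P}(\mathbb{R}^d)$-valued random variable with (random) Lebesgue density $\hat q$, measurable with respect to a sub-$\sigma$-algebra $\mathcal{F}\subseteq\Sigma$, such that $P\ll\hat Q$ almost surely. Conditionally on $\hat Q$, the $\mathbb{R}^d$-valued random variables $X_1,\dots,X_n$ are conditionally independent with common distribution $\hat Q$ (so $\mathbb{E}[g(X_i)\mid\hat Q]=\int g\,\mathrm{d}\hat Q$ a.s.). $Z\sim P$ is a random variable independent of $\mathcal{F}$. $\hat\rho=\mathrm{d}P/\mathrm{d}\hat Q=p/\hat q$ is the random Radon--Nikodym derivative. The mean integrated absolute error is $\mathrm{MIAE}(\hat q)=\mathbb{E}\int_{\mathbb{R}^d}|\hat q(x)-p(x)|\,\mathrm{d}x$. All upper bounds are understood in the extended real sense and may equal $+\infty$. The implied constant in $\mathcal{O}(\cdot)$ does not depend on $n$ or on $\hat q$.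
   Formalization: The random density q̂ is assumed jointly measurable in (ω,x) with respect to σ(Q̂) and the Borel sets, i.e. a functional of Q̂; without this, altering q̂ at the sample points X_i, a Lebesgue-null set, makes unbiasedness fail. *)

(* Defs.v *)
From HB Require Import structures.
From mathcomp Require Import all_boot all_order all_algebra.
From mathcomp Require Import all_classical all_reals all_analysis.

Set Implicit Arguments.
Unset Strict Implicit.
Unset Printing Implicit Defensive.
Import Order.TTheory GRing.Theory Num.Theory.
Import numFieldNormedType.Exports.

Local Open Scope classical_set_scope.
Local Open Scope ring_scope.

(** [R^d] is [d.-tuple R] with the library's product sigma-algebra, which is
    the Borel sigma-algebra of [R^d]. *)

Section lebesgue_tuple.
Context {R : realType}.

Definition cons_pair (n : nat) (z : n.-tuple R * R) : n.+1.-tuple R :=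
  [the n.+1.-tuple R of z.2 :: z.1].

Lemma measurable_cons_pair (n : nat) :
  measurable_fun [set: n.-tuple R * R] (@cons_pair n).
Proof. exact: measurable_cons. Qed.

Section succ.
Variables (n : nat) (mu : {measure set (n.-tuple R) -> \bar R}).

Definition lebesgue_succ : set (n.+1.-tuple R) -> \bar R :=
  pushforward (mu \x @lebesgue_measure R)%E (@cons_pair n).

Let mpre (A : set (n.+1.-tuple R)) : measurable A ->
  measurable (@cons_pair n @^-1` A).
Proof.
by move=> mA; rewrite -[X in measurable X]setTI; exact: measurable_cons_pair.
Qed.

Let lebesgue_succ0 : lebesgue_succ set0 = 0%E.
Proof. by rewrite /lebesgue_succ /pushforward preimage_set0 measure0. Qed.

Let lebesgue_succ_ge0 A : (0 <= lebesgue_succ A)%E.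
Proof. by rewrite /lebesgue_succ /pushforward measure_ge0. Qed.

Let lebesgue_succ_sigma_additive : semi_sigma_additive lebesgue_succ.
Proof.
move=> F mF tF mUF; rewrite /lebesgue_succ /pushforward preimage_bigcup.
apply: measure_semi_sigma_additive.
- by move=> k; exact: mpre.
- apply/trivIsetP => /= i j _ _ ij; rewrite -preimage_setI.
  by move/trivIsetP : tF => /(_ _ _ _ _ ij) ->//; rewrite preimage_set0.
- by rewrite -preimage_bigcup; exact: mpre.
Qed.

HB.instance Definition _ := isMeasure.Build _ _ _ lebesgue_succ
  lebesgue_succ0 lebesgue_succ_ge0 lebesgue_succ_sigma_additive.

End succ.

(** [d]-dimensional Lebesgue measure: the unit mass on the one-point space
    [R^0], then [lambda^n (x) lambda] transported along [(t, x) |-> x :: t]. *)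
Fixpoint lebesgue_tuple (d : nat) : {measure set (d.-tuple R) -> \bar R} :=
  match d with
  | 0%N =>
      [the {measure set (0.-tuple R) -> \bar R} of \d_([tuple] : 0.-tuple R)]
  | n.+1 => [the {measure set (n.+1.-tuple R) -> \bar R} of
              lebesgue_succ (lebesgue_tuple n)]
  end.

Lemma lebesgue_tuple_box (d : nat) (A : 'I_d -> set R) :
  (forall i, measurable (A i)) ->
  lebesgue_tuple d [set t | forall i, A i (tnth t i)] =
  (\prod_(i < d) lebesgue_measure (A i))%E.
Proof.
elim: d A => [|n IH] A mA.
  rewrite big_ord0 /= diracE mem_set//= => i; by case: i.
rewrite big_ord_recl /= /lebesgue_succ /pushforward.
set B := [set t : n.-tuple R | forall i, A (lift ord0 i) (tnth t i)].
have -> : @cons_pair n @^-1` [set t | forall i, A i (tnth t i)] = B `*` A ord0.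
  apply/seteqP; split => -[t x] /=.
    move=> tA; split => [i|]; last by have := tA ord0; rewrite /cons_pair/= tnth0.
    by have := tA (lift ord0 i); rewrite /cons_pair/= tnthS.
  move=> [tB xA] i; rewrite /cons_pair/=.
  case: (unliftP ord0 i) => [j ->|->]; first by rewrite tnthS; exact: tB.
  by rewrite tnth0.
rewrite [LHS]product_measure1E.
- have -> : lebesgue_tuple n B = _ := IH _ (fun i => mA (lift ord0 i)).
  by rewrite muleC.
- rewrite (_ : B = \bigcap_(i in [set: 'I_n])
      ((fun t => tnth t i) @^-1` A (lift ord0 i))); last first.
    by apply/seteqP; split => t tB i; [move=> _; exact: tB|exact: tB].
  apply: fin_bigcap_measurable => // i _.
  by rewrite -[X in measurable X]setTI; exact: measurable_tnth.
- exact: mA.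
Qed.

End lebesgue_tuple.

Section conditioning.
Context (d : measure_display) (Omega : measurableType d) (R : realType).
Variable Pr : probability Omega R.

Definition sigma_of (d' : measure_display) (T : measurableType d')
    (Y : Omega -> T) : set (set Omega) :=
  preimage_set_system [set: Omega] Y measurable.

(** [E[U | G] = V] almost surely, i.e. [V] is a version of the conditional
    expectation of [U] given the sub-sigma-algebra [G]. *)
Definition cond_expectation_is (G : set (set Omega)) (U V : Omega -> R) :
    Prop :=
  [/\ Pr.-integrable [set: Omega] (EFin \o U),
      Pr.-integrable [set: Omega] (EFin \o V),
      sigma_of V `<=` G &
      forall A, G A ->
        (\int[Pr]_(w in A) (V w)%:E = \int[Pr]_(w in A) (U w)%:E)%E].

Definition cond_law_is (d' : measure_display) (T : measurableType d')
    (G : set (set Omega)) (X : Omega -> T) (K : Omega -> set T -> \bar R) : Prop :=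
  forall B : set T, measurable B ->
    cond_expectation_is G \1_(X @^-1` B) (fun w => fine (K w B)).

(** Taking some [B i] to be the whole space covers all finite subfamilies. *)
Definition cond_independent (d' : measure_display) (T : measurableType d')
    (n : nat) (G : set (set Omega)) (X : 'I_n -> Omega -> T) : Prop :=
  forall (B : 'I_n -> set T) (V : 'I_n -> Omega -> R),
    (forall i, measurable (B i)) ->
    (forall i, cond_expectation_is G \1_(X i @^-1` B i) (V i)) ->
    cond_expectation_is G \1_(\bigcap_(i in [set: 'I_n]) (X i @^-1` B i))
      (fun w => \prod_(i < n) V i w).

Definition independent_of (d' : measure_display) (T : measurableType d')
    (F : set (set Omega)) (Z : Omega -> T) : Prop :=
  forall A B, F A -> measurable B ->
    Pr (A `&` Z @^-1` B) = (Pr A * Pr (Z @^-1` B))%E.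

End conditioning.

Definition has_density (R : realType) (d : measure_display)
    (T : measurableType d) (mu : {measure set T -> \bar R})
    (P : probability T R) (g : T -> R) : Prop :=
  [/\ measurable_fun [set: T] g, (forall x, 0 <= g x) &
      forall B, measurable B -> P B = (\int[mu]_(x in B) (g x)%:E)%E].

Section importance_sampling.
Context (R : realType) (dim : nat).
Context (d : measure_display) (Omega : measurableType d).
Variable Pr : probability Omega R.

(** A random proposal: [Q] is a random element of the space of Borel
    probability measures ([pprobability] carries the sigma-algebra generated by
    the evaluations) and [q w] is a Lebesgue density of [Q w].  The density is a
    functional of the proposal, so it is jointly measurable for
    [sigma(Q) (x) Borel]: measurability in [w] for a larger sigma-algebra would
    allow [q w] to be altered on the null set [{X_1(w), .., X_n(w)}]. *)
Definition random_proposal (P : probability (dim.-tuple R) R)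
    (F : set (set Omega)) (Q : Omega -> pprobability (dim.-tuple R) R)
    (q : Omega -> dim.-tuple R -> R) : Prop :=
  [/\ sigma_of Q `<=` F,
      measurable_fun [set: g_sigma_algebraType (sigma_of Q) * dim.-tuple R]
        (fun z => q z.1 z.2),
      {ae Pr, forall w, has_density (lebesgue_tuple dim) (Q w) (q w)} &
      {ae Pr, forall w, P `<< (Q w : probability _ R)}].

Definition importance_weight (p : dim.-tuple R -> R)
    (q : Omega -> dim.-tuple R -> R) (w : Omega) (x : dim.-tuple R) : R :=
  p x / q w x.

Definition target_integral (p f : dim.-tuple R -> R) : R :=
  \int[lebesgue_tuple dim]_x (f x * p x).

Definition importance_estimator (n : nat) (p f : dim.-tuple R -> R)
    (q : Omega -> dim.-tuple R -> R) (X : 'I_n -> Omega -> dim.-tuple R)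
    (w : Omega) : R :=
  n%:R^-1 * \sum_(i < n) importance_weight p q w (X i w) * f (X i w).

Definition MIAE (p : dim.-tuple R -> R) (q : Omega -> dim.-tuple R -> R) :
    \bar R :=
  (\int[Pr]_w \int[lebesgue_tuple dim]_x `|q w x - p x|%:E)%E.

End importance_sampling.

(* Main.v *)
Require Import Defs.
From HB Require Import structures.
From mathcomp Require Import all_boot all_order all_algebra.
From mathcomp Require Import all_classical all_reals all_analysis.
From mathcomp Require Import measurable_realfun ring lra.

Set Implicit Arguments.
Unset Strict Implicit.
Unset Printing Implicit Defensive.
Import Order.TTheory GRing.Theory Num.Theory.
Import numFieldNormedType.Exports.

Local Open Scope classical_set_scope.
Local Open Scope ring_scope.

(** Write [K] for the random proposal, [rho = p / q] for the weight, and
    condition on [K].  Since [P << K], integrating [rho h] against [K] is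
    integrating [h] against [P] ([change_of_measure]); hence each summand
    [rho(X_i) f(X_i)] has conditional mean [I(f)], whatever the proposal is, and
    this is unbiasedness ([average_conditional_mean]).

    For the variance, the summands are conditionally independent with the
    constant conditional mean [I(f)], so the centred summands are orthogonal and
    only the diagonal survives.  Its value is the second moment
    [E int rho f^2 dP], which exceeds [int f^2 dP] by at most
    [E int |rho - 1| f^2 dP] ([average_second_moment], [variance_bound]).

    That second moment may be infinite, so the error bound goes through a
    truncation at a level [t > 1].  Where [rho <= t] the second moment is at most
    [t ||f||^2], and the fluctuation of the average is at most
    [||f|| sqrt (t / n)].  Where [rho > t] one has [|q - p| >= p (t - 1) / t], so
    the event has expected [P]-mass at most [t / (t - 1)] times the mean
    integrated absolute error [M] ([tail_mass]); by Cauchy-Schwarz it contributes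
    at most [2 ||f|| sqrt (t M / (t - 1))] ([truncated_error]).  The sum of the
    two is least at [t = 1 + (4 n M)^(1/3)], where it is the stated bound
    ([mean_abs_deviation]).

    The joint law of the proposal and the sample is only given on rectangles; the
    lemma [disintegration] turns this into a formula for the expectation of an
    arbitrary measurable function of the proposal and a sample point.  Using it a
    second time, with the pair (proposal, [X_i]) in the role of the proposal, gives
    the cross terms of the variance. *)

(** * Integrals as monotone linear functionals *)

(** The standard machine: indicators, then simple functions, then monotone
    limits.  It serves both for densities and for iterated integrals against a
    kernel, which is why the functional [L] is kept abstract. *)
Section functional_integral.
Context d (T : measurableType d) (R : realType).
Variables (mu : {measure set T -> \bar R}) (L : (T -> \bar R) -> \bar R).
Local Open Scope ereal_scope.

Hypothesis L_indic : forall A, measurable A -> L (EFin \o \1_A) = mu A.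
Hypothesis L_add : forall f g : T -> \bar R,
  measurable_fun [set: T] f -> measurable_fun [set: T] g ->
  (forall x, 0 <= f x) -> (forall x, 0 <= g x) ->
  L (fun x => f x + g x) = L f + L g.
Hypothesis L_scale : forall (k : R) (f : T -> \bar R),
  measurable_fun [set: T] f -> (forall x, 0 <= f x) -> (0 <= k)%R ->
  L (fun x => k%:E * f x) = k%:E * L f.
Hypothesis L_lim : forall f_ : nat -> T -> \bar R,
  (forall n, measurable_fun [set: T] (f_ n)) -> (forall n x, 0 <= f_ n x) ->
  (forall x, nondecreasing_seq (f_ ^~ x)) ->
  L (fun x => limn (f_ ^~ x)) = limn (fun n => L (f_ n)).

Import HBNNSimple.

Let L_nnsfun (h : {nnsfun T >-> R}) :
  L (fun x => (h x)%:E) = \int[mu]_x (h x)%:E.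
Proof.
have L0 : L (fun=> 0) = 0.
  transitivity (mu set0); last exact: measure0.
  rewrite -L_indic//; by congr (L _); apply/funext => x; rewrite /= indic0.
have Lterm r : L (fun x => r%:E * (\1_(h @^-1` [set r]) x)%:E) =
    r%:E * mu (h @^-1` [set r]).
  have [r0|r0] := leP 0%R r.
    rewrite L_scale//; first by rewrite L_indic//; exact: measurable_funPTI.
    exact/measurable_EFinP.
  rewrite preimage_nnfun0// measure0 mule0 -L0.
  by congr (L _); apply/funext => x; rewrite indic0 mule0.
have Lsum (s : seq R) :
    L (fun x => \sum_(r <- s) (r%:E * (\1_(h @^-1` [set r]) x)%:E)) =
    \sum_(r <- s) r%:E * mu (h @^-1` [set r]).
  elim: s => [|r s ih].
    by rewrite big_nil -L0; congr (L _); apply/funext => x; rewrite big_nil.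
  rewrite big_cons -ih -Lterm -L_add.
  - by congr (L _); apply/funext => x; rewrite big_cons.
  - by apply: measurable_funeM; exact/measurable_EFinP.
  - apply: emeasurable_sum => u.
    by apply: measurable_funeM; exact/measurable_EFinP.
  - by move=> x; rewrite nnfun_muleindic_ge0.
  - by move=> x; apply: sume_ge0 => u _; rewrite nnfun_muleindic_ge0.
rewrite integralT_nnsfun sintegralE fsbig_finite//= -Lsum.
congr (L _); apply/funext => x.
by rewrite fimfunE -fsumEFin// fsbig_finite.
Qed.

Lemma functional_integral (f : T -> \bar R) :
  measurable_fun [set: T] f -> (forall x, 0 <= f x) -> L f = \int[mu]_x f x.
Proof.
move=> mf f0; pose h := nnsfun_approx measurableT mf.
have fE : f = fun x => limn ((fun n x => (h n x)%:E) ^~ x).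
  apply/funext => x; apply/esym/cvg_lim => //.
  exact: cvg_nnsfun_approx.
have mh n : measurable_fun [set: T] (fun x => (h n x)%:E).
  exact/measurable_EFinP.
have h0 n x : 0 <= (h n x)%:E by rewrite lee_fin.
have ndh x : nondecreasing_seq ((fun n x => (h n x)%:E) ^~ x).
  by move=> m n mn; rewrite lee_fin; exact/lefP/nd_nnsfun_approx.
rewrite [in LHS]fE L_lim// [in RHS]fE monotone_convergence//.
by congr (limn _); apply/funext => n; rewrite L_nnsfun.
Qed.

End functional_integral.

(** Integration of [h g] is a monotone linear functional of [h], and by definition
    of the density its value on an indicator is the measure of the set. *)
Lemma integral_density d (T : measurableType d) (R : realType)
    (nu : {measure set T -> \bar R}) (P : probability T R) (g : T -> R)
    (h : T -> \bar R) :
  has_density nu P g -> measurable_fun [set: T] h -> (forall x, 0 <= h x)%E ->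
  (\int[nu]_x (h x * (g x)%:E) = \int[P]_x h x)%E.
Proof.
move=> [mg g0 Pg] mh h0.
have mEg : measurable_fun [set: T] (EFin \o g) by exact/measurable_EFinP.
have Eg0 x : (0 <= (g x)%:E)%E by rewrite lee_fin.
pose L (u : T -> \bar R) := (\int[nu]_x (u x * (g x)%:E))%E.
rewrite -[LHS]/(L h); apply: functional_integral => // {mh h0 h}.
- move=> A mA; rewrite [RHS](Pg A mA) [RHS]integral_mkcond; apply: eq_integral => x _.
  by rewrite patchE /= indicE; case: ifPn => _; rewrite ?mul1e ?mul0e.
- move=> u v mu mv u0 v0; rewrite /L.
  under eq_integral do rewrite ge0_muleDl//.
  rewrite ge0_integralD//; try by move=> x _; exact: mule_ge0.
  + exact: emeasurable_funM.
  + exact: emeasurable_funM.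
- move=> k u mu u0 k0; rewrite /L.
  under eq_integral do rewrite -muleA.
  rewrite ge0_integralZl//; last by move=> x _; exact: mule_ge0.
  exact: emeasurable_funM.
- move=> u mu u0 ndu; rewrite /L -monotone_convergence//.
  + apply: eq_integral => x _; apply/esym/cvg_lim => //.
    apply: cvgeZr => //; apply: ereal_nondecreasing_is_cvgn; exact: ndu.
  + by move=> n; exact: emeasurable_funM.
  + by move=> n x _; exact: mule_ge0.
  + by move=> x _ m n mn; rewrite lee_wpmul2r//; exact: ndu.
Qed.

Lemma integral_density_signed d (T : measurableType d) (R : realType)
    (nu : {measure set T -> \bar R}) (P : probability T R) (g f : T -> R) :
  has_density nu P g -> measurable_fun [set: T] f ->
  (\int[nu]_x (f x * g x)%:E = \int[P]_x (f x)%:E)%E.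
Proof.
move=> gP mf; have [_ g0 _] := gP.
have mEf : measurable_fun [set: T] (EFin \o f) by exact/measurable_EFinP.
rewrite [LHS]integralE [RHS]integralE; congr (_ - _)%E.
- rewrite -(integral_density gP)//; last exact: measurable_funepos.
  apply: eq_integral => x _.
  by rewrite !funeposE /= EFinM maxe_pMl ?mul0e ?lee_fin.
- rewrite -(integral_density gP)//; last exact: measurable_funeneg.
  apply: eq_integral => x _.
  by rewrite !funenegE /= -mulNr EFinM maxe_pMl ?mul0e ?lee_fin.
Qed.

(** * Disintegration of a joint law *)

Section disintegration.
Context d1 d2 d3 (Omega : measurableType d1) (S : measurableType d2)
  (T : measurableType d3) (R : realType).
Variables (Pr : probability Omega R) (Y : Omega -> S) (X : Omega -> T).
Variable K : S -> pprobability T R.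
Hypotheses (mY : measurable_fun [set: Omega] Y)
  (mX : measurable_fun [set: Omega] X) (mK : measurable_fun [set: S] K).
Local Open Scope ereal_scope.
Hypothesis YXK : forall A B, measurable A -> measurable B ->
  Pr (Y @^-1` A `&` X @^-1` B) = \int[Pr]_(w in Y @^-1` A) K (Y w) B.

Let k : R.-pker S ~> T := kprobability mK.

Lemma measurable_kernel_integral (g : S * T -> \bar R) :
  measurable_fun [set: S * T] g -> (forall z, 0 <= g z) ->
  measurable_fun [set: S] (fun s => \int[K s]_x g (s, x)).
Proof.
by move=> mg g0; exact: (measurable_fun_integral_finite_kernel g k).
Qed.

#[local] HB.instance Definition _ := isMeasurableFun.Build _ _ _ _ Y mY.

Let YX w := (Y w, X w).

Let mYX : measurable_fun [set: Omega] YX.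
Proof. exact: measurable_fun_pair. Qed.

#[local] HB.instance Definition _ := isMeasurableFun.Build _ _ _ _ YX mYX.

(* The law of [Y] is seen as a kernel from a one-point space, so that its product
   with [K] is a product of kernels. *)
Let law : unit -> pprobability S R := fun=> distribution Pr Y.

Let mlaw : measurable_fun [set: unit] law.
Proof. exact: measurable_cst. Qed.

Let mKsnd : measurable_fun [set: unit * S] (K \o snd).
Proof. exact: measurableT_comp. Qed.

Let k1 : R.-pker unit ~> S := kprobability mlaw.
Let k2 : R.-pker (unit * S)%type ~> T := kprobability mKsnd.
Let KP : {measure set (S * T) -> \bar R} := mkproduct k1 k2 tt.

Let KPE A : measurable A ->
  KP A = \int[Pr]_w \int[K (Y w)]_x (\1_A (Y w, x))%:E.
Proof.
move=> mA.
rewrite [LHS](@ge0_integral_distribution _ _ _ _ _ _ Y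
  (fun s => \int[K s]_x (\1_A (s, x))%:E))//.
- apply: (@measurable_kernel_integral (EFin \o \1_A)) => //.
    exact/measurable_EFinP.
  by move=> z; rewrite lee_fin.
- by move=> s; apply: integral_ge0 => x _; rewrite lee_fin.
Qed.

Let disintegration_set A : measurable A ->
  Pr (YX @^-1` A) = \int[Pr]_w \int[K (Y w)]_x (\1_A (Y w, x))%:E.
Proof.
move=> mA; rewrite -KPE//.
pose G := [set A `*` B | A in @measurable _ S & B in @measurable _ T].
apply: (measure_unique G (fun=> setT) _ _ _ _ (distribution Pr YX) KP) => //.
- exact: measurable_prod_measurableType.
- move=> _ _ [A1 mA1 [B1 mB1 <-]] [A2 mA2 [B2 mB2 <-]].
  exists (A1 `&` A2); first exact: measurableI.
  by exists (B1 `&` B2); [exact: measurableI|rewrite setXI].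
- by move=> _; exists setT => //; exists setT => //; rewrite setXTT.
- by rewrite bigcup_const.
- move=> _ [A1 mA1 [B1 mB1 <-]]; rewrite KPE; last exact: measurableX.
  rewrite [LHS]YXK// integral_mkcond; apply: eq_integral => w _.
  rewrite patchE; have [YA|YA] := boolP (w \in Y @^-1` A1).
    transitivity (\int[K (Y w)]_x (\1_B1 x)%:E).
      by rewrite integral_indic// setIT.
    apply: eq_integral => x _; rewrite !indicE in_setX/=.
    by have /= -> : Y w \in A1 by exact: YA.
  symmetry; apply: integral0_eq => x _; rewrite indicE in_setX/=.
  by have /= /negbTE -> : Y w \notin A1 by exact: YA.
- by move=> _; rewrite (le_lt_trans (probability_le1 _ _))// ltry.
Qed.

(** By [disintegration_set], the law of [(Y, X)] is the product of the law of [Y]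
    with the kernel; the hypothesis says so on rectangles, which form a
    generating pi-system.  [functional_integral] passes from sets to functions. *)
Lemma disintegration (g : S * T -> \bar R) :
  measurable_fun [set: S * T] g -> (forall z, 0 <= g z) ->
  \int[Pr]_w g (Y w, X w) = \int[Pr]_w \int[K (Y w)]_x g (Y w, x).
Proof.
move=> mg g0.
rewrite -[LHS](@ge0_integral_distribution _ _ _ _ _ _ YX g)//.
pose L (u : S * T -> \bar R) := \int[Pr]_w \int[K (Y w)]_x u (Y w, x).
have mL (u : S * T -> \bar R) : measurable_fun [set: S * T] u ->
    (forall z, 0 <= u z) ->
    measurable_fun [set: Omega] (fun w => \int[K (Y w)]_x u (Y w, x)).
  move=> mu u0; apply: (measurableT_comp (measurable_kernel_integral mu u0)).
  exact: mY.
have sec (u : S * T -> \bar R) s : measurable_fun [set: S * T] u ->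
    measurable_fun [set: T] (fun x => u (s, x)).
  by move=> mu; exact: measurableT_comp.
symmetry; rewrite -[LHS]/(L g); apply: functional_integral => // {mg g0 g}.
- by move=> A mA; rewrite /L -disintegration_set.
- move=> u v mu mv u0 v0; rewrite /L -ge0_integralD//.
  + apply: eq_integral => w _; rewrite ge0_integralD//; exact: sec.
  + by move=> w _; apply: integral_ge0.
  + exact: mL.
  + by move=> w _; apply: integral_ge0.
  + exact: mL.
- move=> c u mu u0 c0; rewrite /L -ge0_integralZl//.
  + apply: eq_integral => w _; rewrite ge0_integralZl//; exact: sec.
  + exact: mL.
  + by move=> w _; apply: integral_ge0.
- move=> u mu u0 ndu; rewrite /L -monotone_convergence//.
  + apply: eq_integral => w _; rewrite monotone_convergence//.
    by move=> n; exact: sec.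
  + by move=> n; exact: mL.
  + by move=> n w _; apply: integral_ge0.
  + move=> w _ m n mn; apply: ge0_le_integral => //; try exact: sec.
    by move=> x _; exact: (ndu (Y w, x) m n mn).
Qed.

End disintegration.

Section density_measure.
Context d (T : measurableType d) (R : realType).
Variables (mu : {measure set T -> \bar R}) (f : T -> \bar R).
Hypotheses (mf : measurable_fun [set: T] f) (f0 : forall x, (0 <= f x)%E).

(** The proofs of measurability and positivity are arguments so that the measure
    structure can be attached to this set function. *)
Definition density_measure of measurable_fun [set: T] f
  & (forall x, (0 <= f x)%E) := fun A => (\int[mu]_(x in A) f x)%E.

Local Notation nu := (density_measure mf f0).

Let nu0 : nu set0 = 0%E.
Proof. exact: integral_set0. Qed.

Let nu_ge0 A : (0 <= nu A)%E.
Proof. exact: integral_ge0. Qed.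

Let nu_sigma_additive : semi_sigma_additive nu.
Proof.
move=> F mF tF mUF; rewrite /density_measure ge0_integral_bigcup//.
  apply: is_cvg_ereal_nneg_natsum => n _; exact: integral_ge0.
exact: measurable_funTS.
Qed.

HB.instance Definition _ :=
  isMeasure.Build _ _ _ nu nu0 nu_ge0 nu_sigma_additive.

End density_measure.

Section rectangles.
Context d1 d2 d3 d4 (Omega : measurableType d1) (S1 : measurableType d2)
  (S2 : measurableType d3) (T : measurableType d4) (R : realType).
Variables (Pr : probability Omega R) (Y : Omega -> S1) (Z : Omega -> S2)
  (X : Omega -> T) (K : S1 * S2 -> pprobability T R).
Hypotheses (mY : measurable_fun [set: Omega] Y)
  (mZ : measurable_fun [set: Omega] Z) (mX : measurable_fun [set: Omega] X)
  (mK : measurable_fun [set: S1 * S2] K).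
Local Open Scope ereal_scope.

Let YZ w := (Y w, Z w).

Let mYZ : measurable_fun [set: Omega] YZ.
Proof. exact: measurable_fun_pair. Qed.

#[local] HB.instance Definition _ := isMeasurableFun.Build _ _ _ _ YZ mYZ.

Let mKYZ B (mB : measurable B) : measurable_fun [set: Omega] (fun w => K (YZ w) B).
Proof. exact: (measurableT_comp (measurable_kernel (kprobability mK) B mB) mYZ). Qed.

Let K_ge0 B w : 0 <= K (YZ w) B.
Proof. exact: measure_ge0. Qed.

(** For a fixed [B], both sides are finite measures of [A], so it suffices to
    compare them on rectangles.  This makes [disintegration] applicable when the
    conditioning variable is itself a pair. *)
Lemma joint_law_rectangles :
  (forall A1 A2 B, measurable A1 -> measurable A2 -> measurable B ->
    Pr (Y @^-1` A1 `&` Z @^-1` A2 `&` X @^-1` B) =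
    \int[Pr]_(w in Y @^-1` A1 `&` Z @^-1` A2) K (Y w, Z w) B) ->
  forall A B, measurable A -> measurable B ->
    Pr (YZ @^-1` A `&` X @^-1` B) = \int[Pr]_(w in YZ @^-1` A) K (YZ w) B.
Proof.
move=> H A B mA mB.
have mXB : measurable (X @^-1` B) by rewrite -[X in measurable X]setTI; exact: mX.
pose m1 := pushforward (mrestr Pr mXB) YZ.
pose m2 := pushforward (density_measure Pr (mKYZ mB) (K_ge0 B)) YZ.
pose G := [set A `*` B | A in @measurable _ S1 & B in @measurable _ S2].
apply: (measure_unique G (fun=> setT) _ _ _ _ m1 m2) => //.
- exact: measurable_prod_measurableType.
- move=> _ _ [A1 mA1 [B1 mB1 <-]] [A2 mA2 [B2 mB2 <-]].
  exists (A1 `&` A2); first exact: measurableI.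
  by exists (B1 `&` B2); [exact: measurableI|rewrite setXI].
- by move=> _; exists setT => //; exists setT => //; rewrite setXTT.
- by rewrite bigcup_const.
- by move=> _ [A1 mA1 [A2 mA2 <-]]; exact: H.
- move=> _; apply: (@le_lt_trans _ _ 1); last exact: ltry.
  by apply: probability_le1; rewrite preimage_setT setTI.
Qed.

End rectangles.

Lemma emeasurable_kernel_integral d2 d3 (S : measurableType d2)
    (T : measurableType d3) (R : realType) (K : S -> pprobability T R)
    (g : S * T -> \bar R) :
  measurable_fun [set: S] K -> measurable_fun [set: S * T] g ->
  measurable_fun [set: S] (fun s => \int[K s]_x g (s, x))%E.
Proof.
move=> mK mg.
rewrite (_ : (fun s => _) = (fun s =>
    \int[K s]_x (g^\+ (s, x)) - \int[K s]_x (g^\- (s, x)))%E).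
  apply: emeasurable_funB.
  - apply: (measurable_kernel_integral mK) => //.
    exact: measurable_funepos.
  - apply: (measurable_kernel_integral mK) => //.
    exact: measurable_funeneg.
apply/funext => s; rewrite integralE; congr (_ - _)%E;
by apply: eq_integral => x _; rewrite ?funeposE ?funenegE.
Qed.

Section signed_disintegration.
Context d1 d2 d3 (Omega : measurableType d1) (S : measurableType d2)
  (T : measurableType d3) (R : realType).
Variables (Pr : probability Omega R) (Y : Omega -> S) (X : Omega -> T).
Variable K : S -> pprobability T R.
Hypotheses (mY : measurable_fun [set: Omega] Y)
  (mX : measurable_fun [set: Omega] X) (mK : measurable_fun [set: S] K).
Local Open Scope ereal_scope.
Hypothesis YXK : forall A B, measurable A -> measurable B ->
  Pr (Y @^-1` A `&` X @^-1` B) = \int[Pr]_(w in Y @^-1` A) K (Y w) B.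

(** The inner integral splits into its two parts for every [w], even where both
    are infinite; only the outer integral needs integrability. *)
Lemma integrable_disintegration (g : S * T -> R) :
  measurable_fun [set: S * T] g ->
  Pr.-integrable [set: Omega] (fun w => (g (Y w, X w))%:E) ->
  \int[Pr]_w (g (Y w, X w))%:E = \int[Pr]_w \int[K (Y w)]_x (g (Y w, x))%:E.
Proof.
move=> mg ig.
pose u z := (EFin \o g)^\+ z; pose v z := (EFin \o g)^\- z.
have mEg : measurable_fun [set: S * T] (EFin \o g) by exact/measurable_EFinP.
have mu : measurable_fun [set: S * T] u by exact: measurable_funepos.
have mv : measurable_fun [set: S * T] v by exact: measurable_funeneg.
have u0 z : 0 <= u z by exact: funepos_ge0.
have v0 z : 0 <= v z by exact: funeneg_ge0.
have Du := disintegration mY mX mK YXK mu u0.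
have Dv := disintegration mY mX mK YXK mv v0.
have mI h : measurable_fun [set: S * T] h -> (forall z, 0 <= h z) ->
    measurable_fun [set: Omega] (fun w => \int[K (Y w)]_x h (Y w, x)).
  move=> mh h0.
  exact: (measurableT_comp (measurable_kernel_integral mK mh h0) mY).
have lty h : measurable_fun [set: S * T] h -> (forall z, 0 <= h z) ->
    \int[Pr]_w \int[K (Y w)]_x h (Y w, x) < +oo ->
    Pr.-integrable [set: Omega] (fun w => \int[K (Y w)]_x h (Y w, x)).
  move=> mh h0 hoo; apply/integrableP; split; first exact: mI.
  under eq_integral do rewrite gee0_abs ?integral_ge0//.
  exact: hoo.
have Eu : \int[Pr]_w (fun w => (g (Y w, X w))%:E)^\+ w =
    \int[Pr]_w u (Y w, X w).
  by apply: eq_integral => w _; rewrite /u !funeposE.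
have Ev : \int[Pr]_w (fun w => (g (Y w, X w))%:E)^\- w =
    \int[Pr]_w v (Y w, X w).
  by apply: eq_integral => w _; rewrite /v !funenegE.
rewrite integralE Eu Ev.
rewrite Du Dv -integralB//.
- apply: eq_integral => w _; rewrite [RHS]integralE; congr (_ - _);
  by apply: eq_integral => x _; rewrite /u /v ?funeposE ?funenegE.
- apply: lty => //; rewrite -Du -Eu.
  exact: (integral_funepos_lt_pinfty measurableT ig).
- apply: lty => //; rewrite -Dv -Ev.
  exact: (integral_funeneg_lt_pinfty measurableT ig).
Qed.

End signed_disintegration.

(** * Square-integrable functions *)

Lemma cauchy_schwarz d (T : measurableType d) (R : realType)
    (mu : {measure set T -> \bar R}) (u v : T -> R) (a b : R) :
  measurable_fun [set: T] u -> measurable_fun [set: T] v ->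
  0 <= a -> 0 <= b ->
  (\int[mu]_x (u x ^+ 2)%:E <= (a ^+ 2)%:E)%E ->
  (\int[mu]_x (v x ^+ 2)%:E <= (b ^+ 2)%:E)%E ->
  (\int[mu]_x `|u x * v x|%:E <= (a * b)%:E)%E.
Proof.
move=> mu_ mv a0 b0 ua vb.
have N2 (g : T -> R) (k : R) : 0 <= k ->
    (\int[mu]_x (g x ^+ 2)%:E <= (k ^+ 2)%:E)%E ->
    ('N[mu]_2%:E[EFin \o g] <= k%:E)%E.
  move=> k0 gk; rewrite unlock.
  have -> : k%:E = ((k ^+ 2)%:E `^ 2^-1)%E.
    by rewrite poweR_EFin powR12_sqrt ?sqr_ge0// sqrtr_sqr ger0_norm.
  rewrite gt0_ler_poweR ?in_itv/= ?leey ?lee_fin ?sqr_ge0 ?integral_ge0//.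
  apply: le_trans gk; rewrite le_eqVlt; apply/orP; left; apply/eqP.
  apply: eq_integral => x _.
  by rewrite /= powR_mulrn// real_normK ?num_real.
have -> : (\int[mu]_x `|u x * v x|%:E = 'N[mu]_1[EFin \o (u \* v)%R])%E.
  by rewrite Lnorm1.
have half1 : 2^-1 + 2^-1 = 1 :> R by rewrite [RHS]splitr !div1r.
apply: (le_trans (@hoelder _ _ _ mu u v 2 2 mu_ mv _ _ half1)) => //.
by rewrite EFinM; apply: lee_pmul; rewrite ?Lnorm_ge0//; exact: N2.
Qed.

Lemma Lfun2_norm d (T : measurableType d) (R : realType)
    (mu : {measure set T -> \bar R}) (g : T -> R) : g \in Lfun mu 2%:E ->
  exists2 N : R, 0 <= N & 'N[mu]_2%:E[EFin \o g]%E = N%:E /\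
    (\int[mu]_x (g x ^+ 2)%:E = (N ^+ 2)%:E)%E.
Proof.
move=> g2; have N_ge0 := Lnorm_ge0 mu 2%:E (EFin \o g).
have Nfin : ('N[mu]_2%:E[EFin \o g] \is a fin_num)%E.
  rewrite ge0_fin_numE//; move: g2; rewrite inE => /andP[_].
  by rewrite inE.
exists (fine 'N[mu]_2%:E[EFin \o g]%E); first exact: fine_ge0.
split; first by rewrite fineK.
rewrite -powR_mulrn ?fine_ge0// -poweR_EFin fineK// poweR_Lnorm//.
by apply: eq_integral => x _; rewrite /= powR_mulrn// real_normK ?num_real.
Qed.

Lemma normrM_le_sqrD (R : realFieldType) (a b : R) :
  `|a * b| <= a ^+ 2 + b ^+ 2.
Proof.
have := sqr_ge0 (a + b); have := sqr_ge0 (a - b).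
by rewrite ler_norml => h1 h2; apply/andP; split; nra.
Qed.

Lemma integral_sqr_centered d (T : measurableType d) (R : realType)
    (P : probability T R) (f : T -> R) (N : R) :
  P.-integrable [set: T] (EFin \o f) ->
  P.-integrable [set: T] (EFin \o (fun x => f x ^+ 2)) ->
  (\int[P]_x (f x ^+ 2)%:E = (N ^+ 2)%:E)%E ->
  let I := fine (\int[P]_x (f x)%:E)%E in
  (\int[P]_x ((f x - I) ^+ 2)%:E = (N ^+ 2 - I ^+ 2)%:E)%E.
Proof.
move=> f1 f2 fN I.
have IE : (\int[P]_x (f x)%:E = I%:E)%E.
  by rewrite fineK//; exact: (integrable_fin_num measurableT f1).
have ic : P.-integrable [set: T] (EFin \o cst (I ^+ 2)).
  exact: finite_measure_integrable_cst.
have i1 := integrableZl measurableT (- 2 * I) f1.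
transitivity (\int[P]_x (((f x ^+ 2)%:E + (- 2 * I)%:E * (f x)%:E) +
    (EFin \o cst (I ^+ 2)%R) x))%E.
  by apply: eq_integral => x _; rewrite /= -EFinM -!EFinD; congr EFin; ring.
rewrite integralD//; last exact: (integrableD measurableT f2 i1).
rewrite (integralD measurableT f2 i1) integralZl//.
have -> : (\int[P]_x (EFin \o cst (I ^+ 2)%R) x = (I ^+ 2)%:E)%E.
  transitivity (\int[P]_x (I ^+ 2)%:E)%E => //.
  by rewrite integral_cst//= probability_setT mule1.
by rewrite [X in (X + _ + _)%E]fN IE -EFinM -!EFinD; congr EFin; ring.
Qed.

(** * Importance weights *)

Lemma measurable_invr (R : realType) :
  measurable_fun [set: R] (fun x : R => x^-1).
Proof.
rewrite -(setUv [set 0 : R]); apply/measurable_funU => //.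
  exact: measurableC.
split; first exact: measurable_fun_set1.
apply: open_continuous_measurable_fun.
  rewrite (_ : ~` _ = [set x | x != 0]); first exact: open_neq.
  by apply/seteqP; split => x /= /eqP.
by move=> x; rewrite inE => /= /eqP x0; exact: inv_continuous.
Qed.

(** The sigma-algebra generated by the proposal is represented by a measurable
    map [Y] into a space [S]; the proposal is then the kernel value [K (Y w)], and
    functions of the proposal and a sample point live on [S * T]. *)
Section importance_sampling_model.
Context d1 d2 d3 (Omega : measurableType d1) (S : measurableType d2)
  (T : measurableType d3) (R : realType).
Variables (Pr : probability Omega R) (Y : Omega -> S).
Variables (K : S -> pprobability T R) (q : S * T -> R).
Variables (nu : {measure set T -> \bar R}) (P : probability T R) (p : T -> R).
Hypotheses (mY : measurable_fun [set: Omega] Y)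
  (mK : measurable_fun [set: S] K) (mq : measurable_fun [set: S * T] q).
Hypotheses (p_gt0 : forall x, 0 < p x) (p_density : has_density nu P p).

Local Notation rho := (fun z : S * T => p z.2 / q z).

Lemma measurable_weight : measurable_fun [set: S * T] rho.
Proof.
have [mp _ _] := p_density.
apply: measurable_funM; first exact: (measurableT_comp mp measurable_snd).
exact: (measurableT_comp (@measurable_invr R) mq).
Qed.

Local Open Scope ereal_scope.

(** The set [q = 0], on which the weight takes the junk value [p / 0 = 0], is
    null for the proposal, hence for [P], which the proposal dominates. *)
Lemma change_of_measure (s : S) (h : T -> \bar R) :
  has_density nu (K s) (fun x => q (s, x)) ->
  P `<< (K s : probability T R) ->
  measurable_fun [set: T] h -> (forall x, 0 <= h x) ->
  \int[K s]_x ((rho (s, x))%:E * h x) = \int[P]_x h x.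
Proof.
move=> qK PK mh h0.
have [mqs qs0 KE] := qK; have [mp _ _] := p_density.
have mrho : measurable_fun [set: T] (fun x => rho (s, x)).
  exact: (measurable_fun_pair2 s measurable_weight).
have rho0 x : (0 <= rho (s, x))%R by rewrite divr_ge0// ltW.
pose Z := [set x | q (s, x) = 0%R].
have mZ : measurable Z.
  by rewrite (_ : Z = [set: T] `&` (fun x => q (s, x)) @^-1` [set 0%R]);
    [exact: mqs|rewrite setTI].
have PZ : P Z = 0.
  move/null_content_dominatesP : PK; apply => //.
  rewrite [LHS](KE _ mZ).
  by apply: integral0_eq => x; rewrite /Z/= => ->.
have mrh : measurable_fun [set: T] (fun x => (rho (s, x))%:E * h x).
  by apply: emeasurable_funM => //; exact/measurable_EFinP.
rewrite -(integral_density qK)//; last first.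
  by move=> x; rewrite mule_ge0// lee_fin.
pose h' := h \_ (~` Z).
have mh' : measurable_fun [set: T] h'.
  apply/(measurable_restrictT _ (measurableC mZ)).
  exact: measurable_funTS.
transitivity (\int[nu]_x (h' x * (p x)%:E)).
  apply: eq_integral => x _; rewrite /h' patchE.
  have [xZ|xZ] := boolP (x \in ~` Z).
    have qx : q (s, x) != 0%R by move: xZ; rewrite inE => /eqP.
    by rewrite muleAC -EFinM divfK// muleC.
  have -> : q (s, x) = 0%R.
    by move: xZ; rewrite notin_setE => /contrapT.
  by rewrite mule0 mul0e.
rewrite (integral_density p_density)//; last first.
  by move=> x; rewrite /h' patchE; case: ifPn.
rewrite -integral_mkcond; apply/esym.
rewrite -setTD; exact: ge0_negligible_integral.
Qed.

Hypotheses (qK : {ae Pr, forall w,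
    has_density nu (K (Y w)) (fun x => q (Y w, x))})
  (PK : {ae Pr, forall w, P `<< (K (Y w) : probability T R)}).

Lemma measurable_section_integral (h : S * T -> \bar R) :
  measurable_fun [set: S * T] h -> (forall z, 0 <= h z) ->
  measurable_fun [set: Omega] (fun w => \int[P]_x h (Y w, x)).
Proof.
move=> mh h0; apply: (measurableT_comp (f := fun s => \int[P]_x h (s, x))) => //.
exact: (@measurable_fun_fubini_tonelli_F _ _ _ _ _ P h).
Qed.

(** The absolute value is there because [q (Y w, _)] is a density only for almost
    every [w], so that the weight may be negative for the other ones. *)
Lemma weighted_disintegration (X : Omega -> T) (h : S * T -> \bar R) :
  measurable_fun [set: Omega] X ->
  (forall A B, measurable A -> measurable B ->
    Pr (Y @^-1` A `&` X @^-1` B) = \int[Pr]_(w in Y @^-1` A) K (Y w) B) ->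
  measurable_fun [set: S * T] h -> (forall z, 0 <= h z) ->
  \int[Pr]_w (`|rho (Y w, X w)|%:E * h (Y w, X w)) =
  \int[Pr]_w \int[P]_x h (Y w, x).
Proof.
move=> mX YXK mh h0.
have mg : measurable_fun [set: S * T] (fun z => `|rho z|%:E * h z).
  apply: emeasurable_funM => //; apply/measurable_EFinP.
  exact: (measurableT_comp _ measurable_weight).
have g0 z : 0 <= `|rho z|%:E * h z by rewrite mule_ge0// lee_fin.
rewrite [LHS](disintegration mY mX mK YXK mg g0).
apply: ge0_ae_eq_integral => //.
- exact: (measurableT_comp (measurable_kernel_integral mK mg g0) mY).
- exact: measurable_section_integral.
- by move=> w _; apply: integral_ge0.
- by move=> w _; apply: integral_ge0.
near=> w => _.
have qw : has_density nu (K (Y w)) (fun x => q (Y w, x)) by near: w.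
have Pw : P `<< (K (Y w) : probability T R) by near: w.
have [_ qw0 _] := qw.
rewrite -(change_of_measure qw Pw)//; last exact: measurable_fun_pair2.
by apply: eq_integral => x _; rewrite ger0_norm// divr_ge0// ltW.
Unshelve. all: by end_near. Qed.

(** The integrable version of [change_of_measure]: each of the two parts of
    [rho h] is the weighted part of [h]. *)
Lemma weighted_mean (s : S) (h : T -> R) :
  has_density nu (K s) (fun x => q (s, x)) ->
  P `<< (K s : probability T R) ->
  P.-integrable [set: T] (EFin \o h) ->
  (K s).-integrable [set: T] (fun x => (rho (s, x) * h x)%:E) /\
  \int[K s]_x (rho (s, x) * h x)%:E = \int[P]_x (h x)%:E.
Proof.
move=> qs Ps ih; have [_ qs0 _] := qs.
have mh := measurable_int _ ih.
have rho0 x : (0 <= rho (s, x))%R by rewrite divr_ge0// ltW.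
have mrho : measurable_fun [set: T] (fun x => rho (s, x)).
  exact: (measurable_fun_pair2 s measurable_weight).
split.
  apply/integrableP; split.
    by apply/measurable_EFinP; apply: measurable_funM => //; exact/measurable_EFinP.
  under eq_integral do rewrite /= normrM (ger0_norm (rho0 _)) EFinM.
  rewrite (@change_of_measure s (fun x => `|h x|%:E))//.
    by move/integrableP: ih => [].
  by apply/measurable_EFinP; apply: measurableT_comp => //; exact/measurable_EFinP.
rewrite [LHS]integralE [RHS]integralE; congr (_ - _).
- rewrite -(change_of_measure qs Ps) //; last exact: measurable_funepos.
  apply: eq_integral => x _.
  rewrite !funeposE /= EFinM maxe_pMr ?mule0// lee_fin; exact: (rho0 x).
- rewrite -(change_of_measure qs Ps) //; last exact: measurable_funeneg.
  apply: eq_integral => x _.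
  rewrite !funenegE /= -mulrN EFinM maxe_pMr ?mule0// lee_fin.
  exact: (rho0 x).
Qed.

(** * Averages of a conditionally independent sample *)

Variable f : T -> R.
Hypothesis f_int : P.-integrable [set: T] (EFin \o f).
Variables (n : nat) (X : 'I_n -> Omega -> T).
Hypotheses (mX : forall i, measurable_fun [set: Omega] (X i))
  (law1 : forall i A B, measurable A -> measurable B ->
    Pr (Y @^-1` A `&` X i @^-1` B) = \int[Pr]_(w in Y @^-1` A) K (Y w) B)
  (law2 : forall i j A B C, i != j ->
    measurable A -> measurable B -> measurable C ->
    Pr (Y @^-1` A `&` X i @^-1` B `&` X j @^-1` C) =
    \int[Pr]_(w in Y @^-1` A) (K (Y w) B * K (Y w) C)).

(** The integrand [h] may depend on the proposal, so as to cover both [f] itself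
    and its truncations by the size of the weight.  Domination by [|f|] makes all
    first moments finite and the conditional means bounded by one constant. *)
Section weighted_average.
Variable h : S * T -> R.
Hypotheses (mh : measurable_fun [set: S * T] h)
  (hf : forall z, (`|h z| <= `|f z.2|)%R).

Let h_int (s : S) : P.-integrable [set: T] (EFin \o (fun x => h (s, x))).
Proof.
apply: le_integrable f_int => //.
  by apply/measurable_EFinP; exact: measurable_fun_pair2.
by move=> x _; rewrite lee_fin; exact: hf.
Qed.

Definition section_mean (s : S) : R := fine (\int[P]_x (h (s, x))%:E).

Let m := section_mean.

Let section_meanE s : (m s)%:E = \int[P]_x (h (s, x))%:E.
Proof. by rewrite fineK//; exact: (integrable_fin_num measurableT (h_int s)). Qed.

Lemma measurable_section_mean : measurable_fun [set: S] m.
Proof.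
apply: (measurableT_comp (@fine_measurable R setT measurableT)).
apply: (@emeasurable_kernel_integral _ _ _ _ _ (fun=> P) (EFin \o h)) => //.
exact/measurable_EFinP.
Qed.

Let c := fine (\int[P]_x `|f x|%:E).

Let cE : c%:E = \int[P]_x `|f x|%:E.
Proof.
by rewrite fineK//; exact: (integrable_fin_num measurableT (integrable_norm f_int)).
Qed.

Let mf : measurable_fun [set: T] f.
Proof. by apply/measurable_EFinP; exact: measurable_int f_int. Qed.

Let mh2 s : measurable_fun [set: T] (fun x => h (s, x)).
Proof. exact: measurable_fun_pair2. Qed.

Lemma section_mean_bound s : (`|m s| <= c)%R.
Proof.
rewrite -lee_fin cE -abse_EFin section_meanE.
apply: (le_trans (le_abse_integral _ _ _)) => //.
  by apply/measurable_EFinP.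
apply: ge0_le_integral => //.
- by apply/measurable_EFinP; exact: measurableT_comp.
- by apply/measurable_EFinP; exact: measurableT_comp.
- by move=> x _; rewrite lee_fin; exact: hf.
Qed.

Let G z := (rho z * h z)%R.

Let mG : measurable_fun [set: S * T] G.
Proof. by apply: measurable_funM => //; exact: measurable_weight. Qed.

Let Gi i w := G (Y w, X i w).

Let mYX i : measurable_fun [set: Omega] (fun w => (Y w, X i w)).
Proof. exact: measurable_fun_pair. Qed.

Let mGi i : measurable_fun [set: Omega] (Gi i).
Proof. exact: (measurableT_comp mG (mYX i)). Qed.

Lemma integral_weighted_norm i :
  \int[Pr]_w `|Gi i w|%:E = \int[Pr]_w \int[P]_x `|h (Y w, x)|%:E.
Proof.
rewrite -(@weighted_disintegration (X i) (fun z => `|h z|%:E))//.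
- by apply: eq_integral => w _; rewrite normrM EFinM.
- exact: law1.
- by apply/measurable_EFinP; exact: measurableT_comp.
Qed.

Lemma weighted_integrable i : Pr.-integrable [set: Omega] (EFin \o Gi i).
Proof.
apply/integrableP; split; first exact/measurable_EFinP.
under eq_integral do rewrite /= .
rewrite integral_weighted_norm.
apply: (@le_lt_trans _ _ (\int[Pr]_w c%:E)).
  apply: ge0_le_integral => //.
  - by move=> w _; apply: integral_ge0 => x _; rewrite lee_fin.
  - apply: (measurable_section_integral (h := fun z => `|h z|%:E)) => //.
    by apply/measurable_EFinP; exact: measurableT_comp.
  - move=> w _; rewrite cE; apply: ge0_le_integral => //.
    + by apply/measurable_EFinP; exact: measurableT_comp.
    + by apply/measurable_EFinP; exact: measurableT_comp.
    + by move=> x _; rewrite lee_fin; exact: hf.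
by rewrite integral_cst//= probability_setT mule1 ltry.
Qed.

Let D i w := (Gi i w - m (Y w))%R.

Let mmY : measurable_fun [set: Omega] (fun w => m (Y w)).
Proof. exact: (measurableT_comp measurable_section_mean mY). Qed.

Let mD i : measurable_fun [set: Omega] (D i).
Proof. exact: measurable_funB. Qed.

Let inner_center : {ae Pr, forall w, forall a : R,
  \int[K (Y w)]_x (a * (G (Y w, x) - m (Y w)))%:E = 0}.
Proof.
near=> w => a.
have qw : has_density nu (K (Y w)) (fun x => q (Y w, x)) by near: w.
have Pw : P `<< (K (Y w) : probability T R) by near: w.
have [iG GE] := weighted_mean qw Pw (h_int (Y w)).
have ic : (K (Y w)).-integrable [set: T] (EFin \o cst (m (Y w))).
  exact: finite_measure_integrable_cst.
under eq_integral do rewrite EFinM.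
rewrite integralZl//; last first.
  by under eq_fun do rewrite EFinB; exact: integrableB.
under eq_integral do rewrite EFinB.
rewrite integralB_EFin// GE -section_meanE.
have -> : \int[K (Y w)]_x (m (Y w))%:E = (m (Y w))%:E.
  rewrite integral_cst//.
  rewrite [X in _ * X](_ : _ = 1) ?mule1//.
  exact: (probability_setT (K (Y w) : probability T R)).
by rewrite subee// mule0.
Unshelve. all: by end_near. Qed.

(** Conditional centring: the deviation of a summand from the mean of the section
    is orthogonal to every function of the proposal. *)
Lemma weighted_centered i (psi : S -> R) : measurable_fun [set: S] psi ->
  Pr.-integrable [set: Omega] (EFin \o (fun w => psi (Y w) * D i w)%R) ->
  \int[Pr]_w (psi (Y w) * D i w)%:E = 0.
Proof.
move=> mpsi ipsi.
pose g (z : S * T) := (psi z.1 * (G z - m z.1))%R.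
have mg : measurable_fun [set: S * T] g.
  apply: measurable_funM; first exact: (measurableT_comp mpsi measurable_fst).
  apply: measurable_funB => //.
  exact: (measurableT_comp measurable_section_mean measurable_fst).
rewrite (integrable_disintegration mY (mX i) mK (law1 i) mg ipsi).
rewrite -(integral0 Pr [set: Omega]); apply: ae_eq_integral => //.
- apply: (measurableT_comp (f := fun s => \int[K s]_x (g (s, x))%:E) _ mY).
  apply: (@emeasurable_kernel_integral _ _ _ _ _ K (EFin \o g)) => //.
  exact/measurable_EFinP.
- near=> w => _ /=.
  suff : forall a : R, \int[K (Y w)]_x (a * (G (Y w, x) - m (Y w)))%:E = 0.
    by move=> /(_ (psi (Y w))).
  by near: w.
Unshelve. all: by end_near. Qed.

Hypothesis second_moment :
  \int[Pr]_w \int[P]_x (`|rho (Y w, x)| * h (Y w, x) ^+ 2)%:E < +oo.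

Let S2E i : \int[Pr]_w (Gi i w ^+ 2)%:E =
  \int[Pr]_w \int[P]_x (`|rho (Y w, x)| * h (Y w, x) ^+ 2)%:E.
Proof.
rewrite -(@weighted_disintegration (X i)
  (fun z => (`|rho z| * h z ^+ 2)%:E))//.
- apply: eq_integral => w _; rewrite -EFinM mulrA -expr2.
  by rewrite real_normK ?num_real// -exprMn.
- exact: law1.
- apply/measurable_EFinP; apply: measurable_funM; last exact: measurable_funX.
  exact: (measurableT_comp _ measurable_weight).
- by move=> z; rewrite lee_fin mulr_ge0// sqr_ge0.
Qed.

Let iG2 i : Pr.-integrable [set: Omega] (EFin \o (fun w => Gi i w ^+ 2)%R).
Proof.
apply/integrableP; split.
  by apply/measurable_EFinP; exact: measurable_funX.
under eq_integral do rewrite /= ger0_norm ?sqr_ge0//.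
by rewrite S2E.
Qed.

Let im2 : Pr.-integrable [set: Omega] (EFin \o (fun w => m (Y w) ^+ 2)%R).
Proof.
apply: (@le_integrable _ _ _ Pr _ measurableT _ (EFin \o cst (c ^+ 2)%R)).
- by apply/measurable_EFinP; exact: measurable_funX.
- move=> w _; rewrite lee_fin /= !normrX.
  apply: lerXn2r; rewrite ?nnegrE// (le_trans (section_mean_bound _))//.
  exact: ler_norm.
- exact: finite_measure_integrable_cst.
Qed.

Let iD2 i : Pr.-integrable [set: Omega] (EFin \o (fun w => D i w ^+ 2)%R).
Proof.
apply: (@le_integrable _ _ _ Pr _ measurableT _
  (EFin \o (fun w => 2 * Gi i w ^+ 2 + 2 * m (Y w) ^+ 2)%R)).
- by apply/measurable_EFinP; exact: measurable_funX.
- move=> w _; rewrite lee_fin ger0_norm ?sqr_ge0// ler_normr; apply/orP; left.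
  rewrite /D /= -subr_ge0 [leRHS](_ : _ = (Gi i w + m (Y w)) ^+ 2)%R ?sqr_ge0//.
  by ring.
- exact: (integrableD measurableT (integrableZl measurableT 2 (iG2 i))
    (integrableZl measurableT 2 im2)).
Qed.

Let iDD i j : Pr.-integrable [set: Omega] (EFin \o (fun w => D i w * D j w)%R).
Proof.
apply: (@le_integrable _ _ _ Pr _ measurableT _
  (EFin \o (fun w => D i w ^+ 2 + D j w ^+ 2)%R)).
- by apply/measurable_EFinP; exact: measurable_funM.
- move=> w _; rewrite lee_fin (le_trans (normrM_le_sqrD _ _))//.
  exact: ler_norm.
- exact: (integrableD measurableT (iD2 i) (iD2 j)).
Qed.

Let imD i : Pr.-integrable [set: Omega]
  (EFin \o (fun w => m (Y w) * D i w)%R).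
Proof.
apply: (@le_integrable _ _ _ Pr _ measurableT _
  (EFin \o (fun w => m (Y w) ^+ 2 + D i w ^+ 2)%R)).
- by apply/measurable_EFinP; exact: measurable_funM.
- move=> w _; rewrite lee_fin (le_trans (normrM_le_sqrD _ _))//.
  exact: ler_norm.
- exact: (integrableD measurableT im2 (iD2 i)).
Qed.

(* The deviation [D] is orthogonal to [m], and
   [D^2 = (G^2 - m^2) - 2 m D]. *)
Let D2E i : \int[Pr]_w (D i w ^+ 2)%:E =
  \int[Pr]_w \int[P]_x (`|rho (Y w, x)| * h (Y w, x) ^+ 2)%:E -
  \int[Pr]_w (m (Y w) ^+ 2)%:E.
Proof.
have DE : \int[Pr]_w (D i w ^+ 2)%:E = \int[Pr]_w
    (((Gi i w ^+ 2)%:E - (m (Y w) ^+ 2)%:E) - 2%:E * (m (Y w) * D i w)%:E).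
  apply: eq_integral => w _; rewrite -EFinM -!EFinB; congr (_%:E).
  by rewrite /D; ring.
rewrite DE integralB//; last 2 first.
- exact: (integrableB measurableT (iG2 i) im2).
- exact: (integrableZl measurableT 2 (imD i)).
rewrite integralZl//; last exact: (imD i).
have -> : \int[Pr]_w (m (Y w) * D i w)%:E = 0.
  exact: (weighted_centered measurable_section_mean (imD i)).
rewrite mule0 sube0 (integralB measurableT (iG2 i) im2).
by congr (_ - _); exact: S2E.
Qed.

Let DDE i j : i != j -> \int[Pr]_w (D i w * D j w)%:E = 0.
Proof.
move=> ij.
(* Condition on the proposal and on [X i]: then [D i] is constant, and [X j] still
   has law [K], so that [D j] has conditional mean zero. *)
pose Y' w := (Y w, X i w); pose K' (z : S * T) := K z.1.
have mK' : measurable_fun [set: S * T] K'.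
  exact: (measurableT_comp mK measurable_fst).
have YXK' A B : measurable A -> measurable B ->
    Pr (Y' @^-1` A `&` X j @^-1` B) = \int[Pr]_(w in Y' @^-1` A) K' (Y' w) B.
  apply: (joint_law_rectangles mY (mX i) (mX j) mK') => A1 A2 C mA1 mA2 mC.
  have mKC : measurable_fun [set: S] (fun s => K s C).
    exact: (measurable_kernel (kprobability mK) C mC).
  have mK12 : measurable_fun [set: S * T]
      (fun z => (\1_A1 z.1)%:E * (\1_A2 z.2)%:E * K z.1 C).
    apply: emeasurable_funM; last exact: (measurableT_comp mKC measurable_fst).
    apply: emeasurable_funM; apply/measurable_EFinP.
    - exact: (measurableT_comp (measurable_indic mA1) measurable_fst).
    - exact: (measurableT_comp (measurable_indic mA2) measurable_snd).
  have K12_ge0 (z : S * T) : 0 <= (\1_A1 z.1)%:E * (\1_A2 z.2)%:E * K z.1 C.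
    by rewrite mule_ge0// mule_ge0// lee_fin.
  rewrite law2// integral_mkcond [RHS]integral_mkcond.
  transitivity (\int[Pr]_w
      ((\1_A1 (Y w))%:E * (\1_A2 (X i w))%:E * K (Y w) C)); last first.
    apply: eq_integral => w _; rewrite patchE !indicE in_setI.
    rewrite -[w \in Y @^-1` A1]/(Y w \in A1) -[w \in X i @^-1` A2]/(X i w \in A2).
    by do 2 case: (_ \in _); rewrite /= ?mul0e ?mule0 ?mul1e ?mul0e.
  rewrite [RHS](disintegration mY (mX i) mK (law1 i) mK12 K12_ge0).
  apply: eq_integral => w _ /=; rewrite patchE.
  rewrite -[w \in Y @^-1` A1]/(Y w \in A1).
  under eq_integral do rewrite muleAC.
  rewrite ge0_integralZl//; last 2 first.
  - by apply/measurable_EFinP.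
  - by rewrite mule_ge0// lee_fin.
  rewrite integral_indic// setIT indicE.
  by case: (_ \in _); rewrite /= ?mul1e ?mul0e// muleC.
pose g (z : S * T * T) := ((G z.1 - m z.1.1) * (G (z.1.1, z.2) - m z.1.1))%R.
have mg : measurable_fun [set: S * T * T] g.
  have m1 : measurable_fun [set: S * T * T] (fun z => m z.1.1).
    apply: (measurableT_comp measurable_section_mean).
    exact: (measurableT_comp measurable_fst measurable_fst).
  apply: measurable_funM; apply: measurable_funB => //.
    exact: (measurableT_comp mG measurable_fst).
  apply: (measurableT_comp mG); apply: measurable_fun_pair.
    exact: (measurableT_comp measurable_fst measurable_fst).
  exact: measurable_snd.
rewrite (integrable_disintegration (mYX i) (mX j) mK' YXK' mg (iDD i j)).
rewrite -(integral0 Pr [set: Omega]); apply: ae_eq_integral => //.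
- apply: (measurableT_comp (f := fun z => \int[K' z]_x (g (z, x))%:E) _ (mYX i)).
  apply: (@emeasurable_kernel_integral _ _ _ _ _ K' (EFin \o g)) => //.
  exact/measurable_EFinP.
- near=> w => _ /=.
  suff : forall a : R, \int[K (Y w)]_x (a * (G (Y w, x) - m (Y w)))%:E = 0.
    by move=> /(_ (G (Y w, X i w) - m (Y w))%R).
  by near: w.
Unshelve. all: by end_near. Qed.

(** Conditional independence makes the deviations pairwise orthogonal, so only the
    [n] diagonal terms of the square remain. *)
Lemma average_second_moment : (0 < n)%N ->
  \int[Pr]_w ((n%:R^-1 * \sum_(i < n) (Gi i w - m (Y w))) ^+ 2)%:E =
  n%:R^-1%:E *
  (\int[Pr]_w \int[P]_x (`|rho (Y w, x)| * h (Y w, x) ^+ 2)%:E -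
   \int[Pr]_w (m (Y w) ^+ 2)%:E).
Proof.
move=> n0; set V : \bar R := (X in _ = _ * X).
have E w : ((n%:R^-1 * \sum_(i < n) (Gi i w - m (Y w))) ^+ 2)%:E =
    (n%:R^-1 ^+ 2)%:E * \sum_(i < n) \sum_(j < n) (D i w * D j w)%:E.
  rewrite exprMn EFinM; congr (_ * _); rewrite expr2 big_distrlr/=.
  by rewrite -sumEFin; apply: eq_bigr => i _; rewrite -sumEFin.
under eq_integral do rewrite E.
have iS i : Pr.-integrable [set: Omega]
    (fun w => \sum_(j < n) (D i w * D j w)%:E).
  by apply: integrable_sum => // j _; exact: iDD.
rewrite integralZl//; last by apply: integrable_sum => // i _; exact: iS.
rewrite integral_sum//.
have -> : \sum_(i < n) \int[Pr]_w (\sum_(j < n) (D i w * D j w)%:E) =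
    \sum_(i < n) V.
  apply: eq_bigr => i _; rewrite integral_sum//; last by move=> j; exact: iDD.
  rewrite (bigD1 i)//= big1 ?adde0; last by move=> j ji; rewrite DDE// eq_sym.
  exact: D2E.
have Vfin : V \is a fin_num.
  by rewrite /V -(D2E (Ordinal n0)); exact: (integrable_fin_num measurableT (iD2 (Ordinal n0))).
rewrite -(fineK Vfin); move: (fine V) => v {V Vfin}.
have -> : \sum_(i < n) v%:E = (v *+ n)%:E.
  by rewrite sumr_const card_ord EFin_natmul.
rewrite -!EFinM; congr (_%:E).
have n0' : (n%:R != 0 :> R)%R by rewrite pnatr_eq0 -lt0n.
by rewrite -mulr_natl expr2; field.
Qed.

Lemma average_integrable : Pr.-integrable [set: Omega]
  (EFin \o (fun w => n%:R^-1 * \sum_(i < n) Gi i w)%R).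
Proof.
rewrite (_ : _ \o _ = (fun w => n%:R^-1%:E * \sum_(i < n) (Gi i w)%:E)); last first.
  by apply/funext => w; rewrite /= EFinM sumEFin.
apply: integrableZl => //; apply: integrable_sum => // i _.
exact: weighted_integrable.
Qed.

(** The conditional mean of the average, tested on an event that depends on the
    proposal only. *)
Lemma average_conditional_mean (A : set S) : (0 < n)%N -> measurable A ->
  \int[Pr]_(w in Y @^-1` A) (n%:R^-1 * \sum_(i < n) Gi i w)%:E =
  \int[Pr]_(w in Y @^-1` A) (m (Y w))%:E.
Proof.
move=> n0 mA.
have mYA : measurable (Y @^-1` A) by rewrite -[X in measurable X]setTI; exact: mY.
have iG i : Pr.-integrable (Y @^-1` A) (EFin \o Gi i).
  by apply: integrableS (weighted_integrable i).
have im : Pr.-integrable [set: Omega] (EFin \o (fun w => m (Y w))).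
  apply: (@le_integrable _ _ _ Pr _ measurableT _ (EFin \o cst c)).
  - exact/measurable_EFinP.
  - move=> w _; rewrite lee_fin /=; apply: le_trans (section_mean_bound _) _.
    exact: ler_norm.
  - exact: finite_measure_integrable_cst.
have imA : Pr.-integrable (Y @^-1` A) (EFin \o (fun w => m (Y w))).
  by apply: integrableS im.
have iD i : Pr.-integrable [set: Omega]
    (EFin \o (fun w => \1_A (Y w) * D i w)%R).
  apply: (@le_integrable _ _ _ Pr _ measurableT _ (EFin \o D i)).
  - apply/measurable_EFinP; apply: measurable_funM => //.
    exact: (measurableT_comp (measurable_indic mA) mY).
  - move=> w _; rewrite lee_fin /= normrM ler_piMl// indicE.
    by case: (_ \in _); rewrite ?normr1 ?normr0.
  - by rewrite /D; exact: (integrableB measurableT (weighted_integrable i) im).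
have GE i : \int[Pr]_(w in Y @^-1` A) (Gi i w)%:E =
    \int[Pr]_(w in Y @^-1` A) (m (Y w))%:E.
  have GmE : \int[Pr]_(w in Y @^-1` A) (Gi i w)%:E -
      \int[Pr]_(w in Y @^-1` A) (m (Y w))%:E = 0.
    rewrite -(integralB mYA (iG i) imA).
    rewrite -[RHS](weighted_centered (measurable_indic mA) (iD i)).
    rewrite integral_mkcond; apply: eq_integral => w _.
    rewrite patchE indicE -[w \in Y @^-1` A]/(Y w \in A).
    by case: (_ \in _); rewrite ?mul1r ?mul0r// EFinB.
  have := integrable_fin_num mYA (iG i); have := integrable_fin_num mYA imA.
  move=> fm fG; move: GmE; rewrite -(fineK fm) -(fineK fG) -EFinB => -[].
  by move/eqP; rewrite subr_eq0 => /eqP ->.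
have n0' : (n%:R != 0 :> R)%R by rewrite pnatr_eq0 -lt0n.
under eq_integral do rewrite EFinM -sumEFin.
rewrite integralZl//; last by apply: integrable_sum => // i _; exact: iG.
rewrite integral_sum//.
under eq_bigr do rewrite GE.
rewrite -(fineK (integrable_fin_num mYA imA)).
move: (fine _) => v.
have -> : \sum_(i < n) v%:E = (v *+ n)%:E.
  by rewrite sumr_const card_ord EFin_natmul.
by rewrite -EFinM mulrnAr -mulrnAl -mulr_natl mulfV// mul1r.
Qed.

End weighted_average.

(** * Variance of the estimator *)

Let mf : measurable_fun [set: T] f.
Proof. by apply/measurable_EFinP; exact: measurable_int f_int. Qed.

Let mfs : measurable_fun [set: S * T] (f \o snd).
Proof. exact: (measurableT_comp mf measurable_snd). Qed.

Let mrho_norm : measurable_fun [set: S * T] (fun z => `|rho z|%R).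
Proof. exact: (measurableT_comp _ measurable_weight). Qed.

Let I : R := fine (\int[P]_x (f x)%:E).

Let In w := (n%:R^-1 * \sum_(i < n) (rho (Y w, X i w) * f (X i w)))%R.

Variable N : R.
Hypotheses (N_ge0 : (0 <= N)%R) (f_norm : \int[P]_x (f x ^+ 2)%:E = (N ^+ 2)%:E)
  (n_gt0 : (0 < n)%N).

Let average_sub (g : S * T -> R) (b : R) w :
  (n%:R^-1 * \sum_(i < n) (g (Y w, X i w) - b) =
   n%:R^-1 * \sum_(i < n) g (Y w, X i w) - b)%R.
Proof.
have n0 : (n%:R != 0 :> R)%R by rewrite pnatr_eq0 -lt0n.
rewrite sumrB sumr_const card_ord mulrBr; congr (_ - _)%R.
by rewrite -[(b *+ n)%R]mulr_natl mulKf.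
Qed.

(** The conditional mean is the constant [I], so the variance is the value given
    by [average_second_moment]; then [|rho| <= 1 + |rho - 1|]. *)
Lemma variance_bound :
  \int[Pr]_w ((In w - I) ^+ 2)%:E <=
  n%:R^-1%:E * ((N ^+ 2 - I ^+ 2)%:E +
    \int[Pr]_w \int[P]_x (`|rho (Y w, x) - 1| * f x ^+ 2)%:E).
Proof.
set J := (X in _ + X).
have J0 : 0 <= J.
  by apply: integral_ge0 => w _; apply: integral_ge0 => x _; rewrite lee_fin mulr_ge0// sqr_ge0.
have mJ : measurable_fun [set: S * T]
    (fun z => (`|rho z - 1| * (f \o snd) z ^+ 2)%:E).
  apply/measurable_EFinP; apply: measurable_funM; last exact: measurable_funX.
  apply: measurableT_comp => //; apply: measurable_funB => //.
  exact: measurable_weight.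
have mS2 : measurable_fun [set: S * T]
    (fun z => (`|rho z| * (f \o snd) z ^+ 2)%:E).
  by apply/measurable_EFinP; apply: measurable_funM => //; exact: measurable_funX.
pose S2 := \int[Pr]_w \int[P]_x (`|rho (Y w, x)| * f x ^+ 2)%:E.
have S2J : S2 <= (N ^+ 2)%:E + J.
  rewrite -[(N ^+ 2)%:E](_ : \int[Pr]_w (N ^+ 2)%:E = _); last first.
    by rewrite integral_cst//= probability_setT mule1.
  rewrite -ge0_integralD//.
  - apply: ge0_le_integral => //.
    + by move=> w _; apply: integral_ge0 => x _; rewrite lee_fin mulr_ge0// sqr_ge0.
    + apply: (measurable_section_integral mS2) => z.
      by rewrite lee_fin mulr_ge0// sqr_ge0.
    + apply: emeasurable_funD => //.
      apply: (measurable_section_integral mJ) => z.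
      by rewrite lee_fin mulr_ge0// sqr_ge0.
    move=> w _; rewrite -f_norm -ge0_integralD//.
    + apply: ge0_le_integral => //.
      * by move=> x _; rewrite lee_fin mulr_ge0// sqr_ge0.
      * exact: (measurable_fun_pair2 (Y w) mS2).
      * apply: emeasurable_funD; last exact: (measurable_fun_pair2 (Y w) mJ).
        by apply/measurable_EFinP; exact: measurable_funX.
      * move=> x _; rewrite -EFinD lee_fin -[X in (_ <= X + _)%R]mul1r -mulrDl.
        apply: ler_wpM2r; first exact: sqr_ge0.
        rewrite -[X in (`|X| <= _)%R](subrK 1%R) addrC.
        by rewrite (le_trans (ler_normD _ _))// normr1.
    + by move=> x _; rewrite lee_fin sqr_ge0.
    + by apply/measurable_EFinP; exact: measurable_funX.
    + by move=> x _; rewrite lee_fin mulr_ge0// sqr_ge0.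
    + exact: (measurable_fun_pair2 (Y w) mJ).
  - by move=> w _; rewrite lee_fin sqr_ge0.
  - by move=> w _; apply: integral_ge0 => x _; rewrite lee_fin mulr_ge0// sqr_ge0.
  - apply: (measurable_section_integral mJ) => z.
    by rewrite lee_fin mulr_ge0// sqr_ge0.
have n0 : (0 < n%:R^-1 :> R)%R by rewrite invr_gt0 ltr0n.
(* If the weights are too spread out, the right-hand side is infinite; if not,
   the second moment is finite. *)
have [JE|Joo] := eqVneq J +oo.
  by rewrite JE addey// gt0_muley ?leey// lte_fin.
have S2oo : S2 < +oo.
  by apply: (le_lt_trans S2J); rewrite lte_add_pinfty ?ltry// lt_neqAle Joo leey.
have hf (z : S * T) : (`|(f \o snd) z| <= `|f z.2|)%R by [].
have E := average_second_moment mfs hf S2oo n_gt0.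
rewrite (_ : \int[Pr]_w _ = n%:R^-1%:E * (S2 - (I ^+ 2)%:E)); last first.
  transitivity (n%:R^-1%:E * (S2 - \int[Pr]_w (I ^+ 2)%:E)); last first.
    by rewrite integral_cst//= probability_setT mule1.
  rewrite -[RHS]E; apply: eq_integral => w _; congr ((_ ^+ 2)%:E).
  rewrite (average_sub (fun z => rho z * f z.2)%R); congr (_ - _)%R.
rewrite lee_pmul2l ?lte_fin//.
rewrite EFinB [leRHS]addeAC; exact: leeB.
Qed.

(** * Truncation of the weights *)

(** The weight is cut at [t]: [h] is the part of [f] with weight at most [t] and
    [h'] the rest; [b^2] bounds the expected [P]-mass of the region cut off. *)
Section truncation.
Variables (t b : R).
Hypotheses (t_gt0 : (0 < t)%R) (b_ge0 : (0 <= b)%R).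
Hypothesis tail : \int[Pr]_w \int[P]_x (t < `|rho (Y w, x)|)%R%:R%:E <= (b ^+ 2)%:E.

Let h (z : S * T) : R := (f z.2 * (`|rho z| <= t)%R%:R)%R.
Let h' (z : S * T) : R := (f z.2 * (t < `|rho z|)%R%:R)%R.

Let hh' z : (f z.2 = h z + h' z)%R.
Proof. by rewrite /h /h' ltNge; case: (_ <= t)%R; rewrite /= ?mulr1 ?mulr0 ?addr0 ?add0r. Qed.

Let mtail : measurable_fun [set: S * T] (fun z => (t < `|rho z|)%R%:R : R).
Proof.
apply: (measurableT_comp (f := fun u : bool => u%:R : R)) => //.
exact: measurable_fun_ltr.
Qed.

Let mh : measurable_fun [set: S * T] h.
Proof.
apply: measurable_funM => //.
apply: (measurableT_comp (f := fun u : bool => u%:R : R)) => //.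
exact: measurable_fun_ler.
Qed.

Let mh' : measurable_fun [set: S * T] h'.
Proof. exact: measurable_funM. Qed.

Let hf z : (`|h z| <= `|f z.2|)%R.
Proof. by rewrite /h normrM; case: (_ <= t)%R; rewrite ?normr1 ?normr0 ?mulr1 ?mulr0. Qed.

Let h'f z : (`|h' z| <= `|f z.2|)%R.
Proof. by rewrite /h' normrM; case: (t < _)%R; rewrite ?normr1 ?normr0 ?mulr1 ?mulr0. Qed.

Let B := \int[Pr]_w \int[P]_x `|h' (Y w, x)|%:E.

Let mEh' : measurable_fun [set: S * T] (fun z => `|h' z|%:E).
Proof. by apply/measurable_EFinP; exact: measurableT_comp. Qed.

(* Cauchy-Schwarz on the product of [Pr] and [P]. *)
Let BE : B <= (N * b)%:E.
Proof.
pose YT (z : Omega * T) := (Y z.1, z.2).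
have mYT : measurable_fun [set: Omega * T] YT.
  apply: measurable_fun_pair; last exact: measurable_snd.
  exact: (measurableT_comp mY measurable_fst).
rewrite /B -(@fubini_tonelli1 _ _ _ _ _ Pr P (fun z => `|h' (YT z)|%:E));
  first last.
- by move=> z; rewrite lee_fin.
- exact: (measurableT_comp mEh' mYT).
apply: (@cauchy_schwarz _ _ _ (Pr \x P) (fun z => f z.2)
   (fun z => (t < `|rho (YT z)|)%R%:R : R)) => //.
- exact: (measurableT_comp mf measurable_snd).
- exact: (measurableT_comp mtail mYT).
- rewrite (@fubini_tonelli1 _ _ _ _ _ Pr P (fun z => (f z.2 ^+ 2)%:E)).
  + rewrite /fubini_F /= f_norm.
    by rewrite integral_cst//= probability_setT mule1.
  + apply/measurable_EFinP; apply: measurable_funX.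
    exact: (measurableT_comp mf measurable_snd).
  + by move=> z; rewrite lee_fin sqr_ge0.
- rewrite (@fubini_tonelli1 _ _ _ _ _ Pr P
    (fun z => ((t < `|rho (YT z)|)%R%:R ^+ 2)%:E)).
  + apply: le_trans tail; rewrite /fubini_F /= le_eqVlt.
    apply/orP; left; apply/eqP.
    apply: eq_integral => w _; apply: eq_integral => x _; rewrite /YT /=.
    by case: (t < _)%R; rewrite ?expr1n ?expr0n.
  + apply/measurable_EFinP; apply: measurable_funX.
    exact: (measurableT_comp mtail mYT).
  + by move=> z; rewrite lee_fin sqr_ge0.
Qed.

Let S2h : \int[Pr]_w \int[P]_x (`|rho (Y w, x)| * h (Y w, x) ^+ 2)%:E <=
  (t * N ^+ 2)%:E.
Proof.
rewrite -[leRHS](_ : \int[Pr]_w (t * N ^+ 2)%:E = _); last first.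
  by rewrite integral_cst//= probability_setT mule1.
have mS2 : measurable_fun [set: S * T] (fun z => (`|rho z| * h z ^+ 2)%:E).
  by apply/measurable_EFinP; apply: measurable_funM => //; exact: measurable_funX.
have S20 z : 0 <= (`|rho z| * h z ^+ 2)%:E by rewrite lee_fin mulr_ge0// sqr_ge0.
apply: ge0_le_integral => //.
- by move=> w _; apply: integral_ge0.
- exact: (measurable_section_integral mS2).
move=> w _.
have mEf2 : measurable_fun [set: T] (fun x => (f x ^+ 2)%:E).
  by apply/measurable_EFinP; exact: measurable_funX.
have Ef20 x : 0 <= (f x ^+ 2)%:E by rewrite lee_fin sqr_ge0.
rewrite EFinM -f_norm -ge0_integralZl_EFin// ?(ltW t_gt0)//.
apply: ge0_le_integral => //.
- exact: (measurable_fun_pair2 (Y w) mS2).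
- by apply: measurable_funeM; apply/measurable_EFinP; exact: measurable_funX.
- move=> x _; rewrite -EFinM lee_fin /h; case: (leP _ t) => [rt|_].
    by rewrite mulr1 ler_wpM2r// sqr_ge0.
  by rewrite mulr0 expr0n mulr0 mulr_ge0 ?sqr_ge0// ltW.
Qed.

Let G (g : S * T -> R) w := (n%:R^-1 * \sum_(i < n) (rho (Y w, X i w) * g (Y w, X i w)))%R.

Let mG g : measurable_fun [set: S * T] g -> measurable_fun [set: Omega] (G g).
Proof.
move=> mg; apply: measurable_funM => //; apply: measurable_sum => i.
apply: (measurableT_comp (f := fun z => (rho z * g z)%R)).
  by apply: measurable_funM => //; exact: measurable_weight.
exact: measurable_fun_pair.
Qed.

Let mmean g : measurable_fun [set: S * T] g ->
  measurable_fun [set: Omega] (fun w => section_mean g (Y w)).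
Proof.
move=> mg; exact: (measurableT_comp (measurable_section_mean mg) mY).
Qed.

Let fluctuation :
  \int[Pr]_w `|G h w - section_mean h (Y w)|%:E <= (N * Num.sqrt (t / n%:R))%:E.
Proof.
have S2oo := le_lt_trans S2h (ltry _).
have E := average_second_moment mh hf S2oo n_gt0.
have -> : \int[Pr]_w `|G h w - section_mean h (Y w)|%:E =
    \int[Pr]_w `|(G h w - section_mean h (Y w)) * cst 1%R w|%:E.
  by apply: eq_integral => w _; rewrite mulr1.
rewrite -[X in X%:E]mulr1; apply: cauchy_schwarz => //.
- by apply: measurable_funB; [exact: mG|exact: mmean].
- by rewrite mulr_ge0// sqrtr_ge0.
- have -> : \int[Pr]_w ((G h w - section_mean h (Y w)) ^+ 2)%:E =
    \int[Pr]_w ((n%:R^-1 * \sum_(i < n)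
       (rho (Y w, X i w) * h (Y w, X i w) - section_mean h (Y w))) ^+ 2)%:E.
    apply: eq_integral => w _; congr ((_ ^+ 2)%:E).
    by rewrite (average_sub (fun z => rho z * h z)%R).
  rewrite E exprMn sqr_sqrtr; last by rewrite divr_ge0// ltW.
  rewrite [(N ^+ 2 * _)%R](_ : _ = n%:R^-1 * (t * N ^+ 2))%R; last by ring.
  rewrite EFinM; apply: lee_wpmul2l; first by rewrite lee_fin invr_ge0.
  apply: le_trans S2h; rewrite geeDl// oppe_le0.
  by apply: integral_ge0 => w _; rewrite lee_fin sqr_ge0.
- under eq_integral do rewrite /= expr1n.
  by rewrite integral_cst//= probability_setT expr1n mule1.
Qed.

Let tail_average : \int[Pr]_w `|G h' w|%:E <= B.
Proof.
have mGi i : measurable_fun [set: Omega]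
    (fun w => `|rho (Y w, X i w) * h' (Y w, X i w)|%:E).
  apply/measurable_EFinP; apply: measurableT_comp => //.
  apply: (measurableT_comp (f := fun z => (rho z * h' z)%R)).
    by apply: measurable_funM => //; exact: measurable_weight.
  exact: measurable_fun_pair.
apply: (@le_trans _ _ (\int[Pr]_w (n%:R^-1%:E *
    \sum_(i < n) `|rho (Y w, X i w) * h' (Y w, X i w)|%:E))).
  apply: ge0_le_integral => //.
  - by apply/measurable_EFinP; apply: measurableT_comp => //; exact: mG.
  - by apply: measurable_funeM; exact: emeasurable_sum.
  - move=> w _; rewrite sumEFin -EFinM lee_fin /G normrM ger0_norm ?invr_ge0//.
    by rewrite ler_wpM2l ?invr_ge0// ler_norm_sum.
rewrite ge0_integralZl_EFin ?invr_ge0//; last 2 first.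
- by move=> w _; apply: sume_ge0 => i _; rewrite lee_fin.
- exact: emeasurable_sum.
rewrite ge0_integral_sum//.
under eq_bigr do rewrite (integral_weighted_norm mh') -/B.
have Bfin : B \is a fin_num.
  rewrite ge0_fin_numE; first exact: (le_lt_trans BE (ltry _)).
  by apply: integral_ge0 => w _; apply: integral_ge0 => x _; rewrite lee_fin.
rewrite -(fineK Bfin); move: (fine B) => v.
have -> : \sum_(i < n) v%:E = (v *+ n)%:E.
  by rewrite sumr_const card_ord EFin_natmul.
have n0 : (n%:R != 0 :> R)%R by rewrite pnatr_eq0 -lt0n.
by rewrite -EFinM mulrnAr -mulrnAl -mulr_natl mulfV// mul1r.
Qed.

Let mean_error : \int[Pr]_w `|section_mean h (Y w) - I|%:E <= B.
Proof.
apply: ge0_le_integral => //.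
- apply/measurable_EFinP; apply: measurableT_comp => //.
  by apply: measurable_funB => //; exact: mmean.
- by apply: (measurable_section_integral mEh') => z; rewrite lee_fin.
move=> w _.
have ih : P.-integrable [set: T] (EFin \o (fun x => h (Y w, x))).
  apply: le_integrable f_int => //.
    by apply/measurable_EFinP; exact: (measurable_fun_pair2 (Y w) mh).
  by move=> x _; rewrite lee_fin; exact: hf.
have ih' : P.-integrable [set: T] (EFin \o (fun x => h' (Y w, x))).
  apply: le_integrable f_int => //.
    by apply/measurable_EFinP; exact: (measurable_fun_pair2 (Y w) mh').
  by move=> x _; rewrite lee_fin; exact: h'f.
have IE : (section_mean h (Y w) - I)%:E = - \int[P]_x (h' (Y w, x))%:E.
  have fh := integrable_fin_num measurableT ih.
  have fh' := integrable_fin_num measurableT ih'.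
  rewrite EFinB /section_mean fineK//.
  rewrite [I%:E](_ : _ = \int[P]_x (h (Y w, x))%:E + \int[P]_x (h' (Y w, x))%:E).
    by rewrite fin_num_oppeD// addeA subee// add0e.
  rewrite /I fineK; last exact: (integrable_fin_num measurableT f_int).
  rewrite -integralD//; apply: eq_integral => x _.
  by rewrite -EFinD -hh'.
rewrite -abse_EFin IE abseN; apply: (le_trans (le_abse_integral _ _ _)) => //.
by apply/measurable_EFinP; exact: (measurable_fun_pair2 (Y w) mh').
Qed.

(** The tail [h'] enters twice, once through its weighted average and once
    through the bias [I - section_mean h], whence the factor 2. *)
Lemma truncated_error :
  \int[Pr]_w `|In w - I|%:E <= (N * Num.sqrt (t / n%:R) + 2 * (N * b))%:E.
Proof.
have InE w : (In w = G h w + G h' w)%R.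
  rewrite /In /G -mulrDr -big_split/=; congr (_ * _)%R; apply: eq_bigr => i _.
  by rewrite -mulrDr -hh'.
pose u w := `|G h w - section_mean h (Y w)|%R.
pose v w := `|section_mean h (Y w) - I|%R.
have mu : measurable_fun [set: Omega] u.
  apply: measurableT_comp => //.
  by apply: measurable_funB; [exact: mG|exact: mmean].
have mv : measurable_fun [set: Omega] v.
  by apply: measurableT_comp => //; apply: measurable_funB => //; exact: mmean.
have mG' : measurable_fun [set: Omega] (fun w => `|G h' w|%R).
  by apply: measurableT_comp => //; exact: mG.
apply: (@le_trans _ _ (\int[Pr]_w ((u w)%:E + (`|G h' w|%:E + (v w)%:E)))).
  apply: ge0_le_integral => //.
  - apply/measurable_EFinP; apply: measurableT_comp => //.
    apply: measurable_funB => //; exact: (mG mfs).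
  - apply: emeasurable_funD; first exact/measurable_EFinP.
    by apply: emeasurable_funD; exact/measurable_EFinP.
  - move=> w _; rewrite -!EFinD lee_fin /u /v InE.
    rewrite [(_ - I)%R](_ : _ = (G h w - section_mean h (Y w)) +
      (G h' w + (section_mean h (Y w) - I)))%R; last by ring.
    rewrite (le_trans (ler_normD _ _))// lerD2l.
    exact: ler_normD.
have mEu : measurable_fun [set: Omega] (EFin \o u) by exact/measurable_EFinP.
have mEv : measurable_fun [set: Omega] (EFin \o v) by exact/measurable_EFinP.
have mEG : measurable_fun [set: Omega] (fun w => `|G h' w|%:E).
  exact/measurable_EFinP.
have u0 w : 0 <= (u w)%:E by rewrite lee_fin; exact: normr_ge0.
have v0 w : 0 <= (v w)%:E by rewrite lee_fin; exact: normr_ge0.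
rewrite ge0_integralD//; last 2 first.
- by move=> w _; rewrite adde_ge0// lee_fin.
- exact: emeasurable_funD.
rewrite ge0_integralD//.
rewrite EFinD; apply: leeD; first exact: fluctuation.
rewrite mulr_natl mulr2n EFinD; apply: leeD.
- exact: le_trans tail_average BE.
- exact: le_trans mean_error BE.
Qed.
End truncation.

(** * Mean absolute error of the proposal and of the estimator *)

Let mp : measurable_fun [set: T] p.
Proof. by have [] := p_density. Qed.

Let mps : measurable_fun [set: S * T] (fun z => p z.2).
Proof. exact: (measurableT_comp mp measurable_snd). Qed.

Definition mean_abs_error : \bar R :=
  \int[Pr]_w \int[nu]_x `|q (Y w, x) - p x|%:E.

(* The relative error is integrated against [P], for which Tonelli's theorem
   holds, whereas [nu] is arbitrary. *)
Let relerr (z : S * T) : R := (`|q z - p z.2| / p z.2)%R.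

Let mrelerr : measurable_fun [set: S * T] (EFin \o relerr).
Proof.
apply/measurable_EFinP; apply: measurable_funM; last first.
  exact: (measurableT_comp (@measurable_invr R)).
by apply: measurableT_comp => //; exact: measurable_funB.
Qed.

Let relerr_ge0 z : 0 <= (EFin \o relerr) z.
Proof. by rewrite lee_fin divr_ge0// ltW. Qed.

Let abs_errorE s : \int[nu]_x `|q (s, x) - p x|%:E = \int[P]_x (relerr (s, x))%:E.
Proof.
rewrite -(integral_density p_density)//; last 2 first.
- exact: (measurable_fun_pair2 s mrelerr).
- by move=> x; exact: relerr_ge0.
by apply: eq_integral => x _; rewrite -EFinM /relerr divfK// gt_eqF.
Qed.

(** If [p / |q| > t] then [|q| < p / t], so [|q - p|] is at least
    [p (1 - 1 / t)]. *)
Lemma tail_mass (t : R) : (1 < t)%R ->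
  \int[Pr]_w \int[P]_x (t < `|rho (Y w, x)|)%R%:R%:E <=
  (t / (t - 1))%:E * mean_abs_error.
Proof.
move=> t1; rewrite /mean_abs_error.
have t0 : (0 < t)%R by rewrite (lt_trans ltr01).
have k0 : (0 <= t / (t - 1))%R by apply: divr_ge0; apply: ltW; rewrite ?subr_gt0.
under [X in _ * X]eq_integral do rewrite abs_errorE.
have mtail : measurable_fun [set: S * T] (fun z => (t < `|rho z|)%R%:R%:E : \bar R).
  apply/measurable_EFinP.
  apply: (measurableT_comp (f := fun u : bool => u%:R : R)) => //.
  by apply: measurable_fun_ltr => //; exact: (measurableT_comp _ measurable_weight).
have mI := measurable_section_integral mrelerr relerr_ge0.
have I0 w : 0 <= \int[P]_x (relerr (Y w, x))%:E.
  by apply: integral_ge0 => x _; exact: relerr_ge0.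
have er0 w x : 0 <= (relerr (Y w, x))%:E := relerr_ge0 (Y w, x).
have mer w : measurable_fun [set: T] (fun x => (relerr (Y w, x))%:E).
  exact: (measurable_fun_pair2 (Y w) mrelerr).
rewrite -ge0_integralZl_EFin//.
apply: ge0_le_integral => //.
- by move=> w _; apply: integral_ge0 => x _; rewrite lee_fin.
- by apply: (measurable_section_integral mtail) => z; rewrite lee_fin.
- exact: measurable_funeM.
move=> w _; rewrite -ge0_integralZl_EFin//.
apply: ge0_le_integral => //.
- exact: (measurable_fun_pair2 (Y w) mtail).
- exact: measurable_funeM.
move=> x _; rewrite -EFinM lee_fin /relerr /=.
have px := p_gt0 x; move: (q (Y w, x)) => y.
have [ty|_] := ltP t; last by rewrite mulr_ge0// divr_ge0// ltW.
have y0 : y != 0%R.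
  by apply: contraTneq ty => ->; rewrite invr0 mulr0 normr0 -leNgt ltW.
move: ty; rewrite normrM normfV (gtr0_norm px) ltr_pdivlMr ?normr_gt0// => ty.
have yp : (p x - `|y| <= `|y - p x|)%R.
  by rewrite distrC -[X in (X - _ <= _)%R](gtr0_norm px) lerB_dist.
rewrite /= mulrA ler_pdivlMr// mul1r mulrAC ler_pdivlMr ?subr_gt0//.
by nra.
Qed.

(** Two densities are at distance at most 2, so the error is finite and the bounds
    can be computed with real numbers. *)
Lemma mean_abs_error_le2 : mean_abs_error <= 2%:E.
Proof.
rewrite /mean_abs_error.
have -> : 2%:E = \int[Pr]_w (cst 2%:E w) :> \bar R.
  by rewrite integral_cst//= probability_setT mule1.
under eq_integral do rewrite abs_errorE.
apply: ae_ge0_le_integral => //.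
- by move=> w _; apply: integral_ge0 => x _; exact: relerr_ge0.
- exact: (measurable_section_integral mrelerr relerr_ge0).
- by move=> w _; rewrite lee_fin.
near=> w => _.
have qw : has_density nu (K (Y w)) (fun x => q (Y w, x)) by near: w.
have [mqw qw0 KE] := qw.
have [_ _ PE] := p_density.
rewrite -abs_errorE /=.
have mEq : measurable_fun [set: T] (fun x => (q (Y w, x))%:E) by exact/measurable_EFinP.
have mEp : measurable_fun [set: T] (fun x => (p x)%:E) by exact/measurable_EFinP.
have q0 x : 0 <= (q (Y w, x))%:E by rewrite lee_fin.
have p0 x : 0 <= (p x)%:E by rewrite lee_fin ltW.
apply: (@le_trans _ _ (\int[nu]_x ((q (Y w, x))%:E + (p x)%:E))).
  apply: ge0_le_integral => //.
  - apply/measurable_EFinP; apply: measurableT_comp => //.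
    exact: measurable_funB.
  - exact: emeasurable_funD.
  - move=> x _; rewrite -EFinD lee_fin (le_trans (ler_normB _ _))//.
    by rewrite !ger0_norm// ltW.
rewrite ge0_integralD// -(KE _ measurableT) -(PE _ measurableT).
rewrite [X in X + _](probability_setT (K (Y w) : probability T R)).
by rewrite probability_setT -EFinD.
Unshelve. all: by end_near. Qed.

Lemma weighted_error_swap :
  \int[nu]_x ((\int[Pr]_w `|rho (Y w, x) - 1|%:E) * (f x ^+ 2 * p x)%:E) =
  \int[Pr]_w \int[P]_x (`|rho (Y w, x) - 1| * f x ^+ 2)%:E.
Proof.
pose g (z : Omega * T) := `|rho (Y z.1, z.2) - 1|%:E.
have mYT : measurable_fun [set: Omega * T] (fun z => (Y z.1, z.2)).
  apply: measurable_fun_pair; last exact: measurable_snd.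
  exact: (measurableT_comp mY measurable_fst).
have mg : measurable_fun [set: Omega * T] g.
  apply/measurable_EFinP; apply: measurableT_comp => //.
  apply: measurable_funB => //; exact: (measurableT_comp measurable_weight mYT).
have g0 z : 0 <= g z by rewrite lee_fin.
have mf2 : measurable_fun [set: T] (fun x => (f x ^+ 2)%:E).
  by apply/measurable_EFinP; exact: measurable_funX.
have f20 x : 0 <= (f x ^+ 2)%:E by rewrite lee_fin sqr_ge0.
have mG := @measurable_fun_fubini_tonelli_G _ _ _ _ _ Pr g mg g0.
transitivity (\int[P]_x ((\int[Pr]_w g (w, x)) * (f x ^+ 2)%:E)).
  rewrite -(integral_density p_density).
  - by apply: eq_integral => x _; rewrite EFinM muleA.
  - exact: emeasurable_funM.
  - by move=> x; rewrite mule_ge0// integral_ge0.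
pose g2 z := g z * (f z.2 ^+ 2)%:E.
have mg2 : measurable_fun [set: Omega * T] g2.
  apply: emeasurable_funM => //; exact: (measurableT_comp mf2 measurable_snd).
have g20 z : 0 <= g2 z by rewrite mule_ge0.
transitivity (\int[P]_x \int[Pr]_w g2 (w, x)).
  apply: eq_integral => x _; rewrite -ge0_integralZr//.
  exact: (measurable_fun_pair1 x mg).
rewrite -(@fubini_tonelli _ _ _ _ _ Pr P g2)//.
Qed.

(** The level [t = 1 + B] balances the two terms of [truncated_error]: with
    [b^2 = t M / (t - 1) = t B^2 / (4 n)] they become [sqrt t] and [B sqrt t],
    up to the common factor [N / sqrt n].  If [M = 0] then [t = 1] is not allowed
    by [tail_mass], and the bound is the limit as [t] decreases to 1. *)
Lemma mean_abs_deviation (M B : R) :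
  mean_abs_error = M%:E -> (0 <= B)%R -> (B ^+ 3 = 4 * n%:R * M)%R ->
  \int[Pr]_w `|In w - I|%:E <=
  (N * (Num.sqrt n%:R)^-1 * ((1 + B) * Num.sqrt (1 + B)))%:E.
Proof.
move=> ME B0 B3.
have n0 : (0 < n%:R :> R)%R by rewrite ltr0n.
have sn0 : (0 < Num.sqrt n%:R :> R)%R by rewrite sqrtr_gt0.
have M0 : (0 <= M)%R.
  by rewrite -lee_fin -ME; apply: integral_ge0 => w _; exact: integral_ge0.
have sqrtn t : (Num.sqrt (t / n%:R) = Num.sqrt t * (Num.sqrt n%:R)^-1 :> R)%R.
  by rewrite mulrC sqrtrM ?invr_ge0 ?ltW// sqrtrV ?ltW// mulrC.
have [B_eq0|B_neq0] := eqVneq B 0%R.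
  have M_eq0 : M = 0%R.
    move/eqP: B3; rewrite B_eq0 expr0n/= eq_sym !mulf_eq0 pnatr_eq0/=.
    by rewrite (gt_eqF n0) => /eqP.
  rewrite B_eq0 addr0 sqrtr1 !mulr1.
  set k := (N * _)%R; have k0 : (0 <= k)%R by rewrite mulr_ge0// invr_ge0 ltW.
  apply/lee_addgt0Pr => e e0.
  (* Any [s] with [k s <= e] would do; the [+ 1] covers [k = 0]. *)
  pose s := (e / (k + 1))%R.
  have k1 : (0 < k + 1)%R by rewrite ltr_wpDl.
  have s0 : (0 < s)%R by rewrite divr_gt0.
  have t1 : (1 < 1 + s)%R by rewrite ltrDl.
  have t0 : (0 < 1 + s)%R by rewrite (lt_trans ltr01).
  have tl : \int[Pr]_w \int[P]_x (1 + s < `|rho (Y w, x)|)%R%:R%:E <=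
      (0 ^+ 2)%:E.
    by apply: (le_trans (tail_mass t1)); rewrite ME M_eq0 mule0 expr0n.
  apply: (le_trans (truncated_error t0 (lexx 0%R) tl)).
  rewrite -EFinD lee_fin !mulr0 addr0 sqrtn mulrCA mulrC -/k.
  have st : (Num.sqrt (1 + s) <= 1 + s)%R.
    by have := sqr_sqrtr (ltW t0); have := sqrtr_ge0 (1 + s)%R; nra.
  apply: (le_trans (ler_wpM2l k0 st)).
  rewrite mulrDr mulr1 lerD2l /s mulrA ler_pdivrMr//.
  by nra.
have Bp : (0 < B)%R by rewrite lt_def B_neq0.
have t1 : (1 < 1 + B)%R by rewrite ltrDl.
have t0 : (0 < 1 + B)%R by rewrite (lt_trans ltr01).
pose b := (Num.sqrt (1 + B) * (Num.sqrt n%:R)^-1 * (B / 2))%R.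
have b0 : (0 <= b)%R by rewrite !mulr_ge0 ?invr_ge0 ?sqrtr_ge0 ?divr_ge0.
have tl : \int[Pr]_w \int[P]_x (1 + B < `|rho (Y w, x)|)%R%:R%:E <=
    (b ^+ 2)%:E.
  apply: (le_trans (tail_mass t1)); rewrite ME -EFinM lee_fin.
  rewrite /b !exprMn !exprVn !sqr_sqrtr ?(ltW t0) ?(ltW n0)//.
  rewrite [(1 + B - 1)%R](_ : _ = B); last by ring.
  have -> : (M = B ^+ 3 / (4 * n%:R))%R.
    by rewrite B3; field; rewrite gt_eqF.
  rewrite le_eqVlt; apply/orP; left; apply/eqP.
  by field; rewrite ?gt_eqF.
apply: (le_trans (truncated_error t0 b0 tl)).
rewrite lee_fin sqrtn /b le_eqVlt; apply/orP; left; apply/eqP.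
by field; rewrite gt_eqF.
Qed.

End importance_sampling_model.

(** * Laws conditional on the proposal *)

Section sampling_laws.
Context (d d' : measure_display) (Omega : measurableType d)
  (T : measurableType d') (R : realType).
Variables (Pr : probability Omega R) (Q : Omega -> pprobability T R).
Variables (n : nat) (X : 'I_n -> Omega -> T).
Hypothesis sub : sigma_of Q `<=` measurable.
Hypothesis mX : forall i, measurable_fun [set: Omega] (X i).

Let S := g_sigma_algebraType (sigma_of Q).

Lemma measurable_sigma_of (A : set Omega) :
  (@measurable _ S A : Prop) <-> sigma_of Q A.
Proof.
split; last exact: sub_sigma_algebra.
apply: smallest_sub => //; apply: sigma_algebra_preimage.
exact: sigma_algebra_measurable.
Qed.

Lemma measurable_to_sigma_of : measurable_fun [set: Omega] (id : Omega -> S).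
Proof.
move=> _ A /measurable_sigma_of QA; rewrite setTI preimage_id; exact: sub.
Qed.

Lemma measurable_proposal : measurable_fun [set: S] (Q : S -> pprobability T R).
Proof. by move=> _ B mB; apply/measurable_sigma_of; exists B. Qed.

Let QR := fun w => (Q w : probability T R).

Let fineQ w B : measurable B -> (fine (QR w B))%:E = QR w B.
Proof. by move=> mB; rewrite fineK// fin_num_measure. Qed.

Lemma conditional_law_rectangle i (A B : set _) :
  cond_law_is Pr (sigma_of Q) (X i) QR ->
  sigma_of Q A -> measurable B ->
  (Pr (A `&` X i @^-1` B) = \int[Pr]_(w in A) QR w B)%E.
Proof.
move=> XQ QA mB; have [_ _ _ /(_ A QA) E] := XQ B mB.
have mXB : measurable (X i @^-1` B) by rewrite -[X in measurable X]setTI; exact: mX.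
transitivity (\int[Pr]_(w in A) (\1_(X i @^-1` B) w)%:E)%E.
  by rewrite integral_indic 1?setIC//; exact: sub.
by rewrite -E; apply: eq_integral => w _; exact: fineQ.
Qed.

(** Conditional independence is applied to the family of sets that is [B] at [i],
    [C] at [j] and the whole space elsewhere; the other factors are then 1. *)
Lemma conditional_law_pair i j (A : set Omega) (B C : set T) : i != j ->
  (forall k, cond_law_is Pr (sigma_of Q) (X k) QR) ->
  cond_independent Pr (sigma_of Q) X ->
  sigma_of Q A -> measurable B -> measurable C ->
  (Pr (A `&` X i @^-1` B `&` X j @^-1` C) =
   \int[Pr]_(w in A) (QR w B * QR w C))%E.
Proof.
move=> ij XQ indep QA mB mC.
pose D k := if k == i then B else if k == j then C else [set: T].
have mD k : measurable (D k) by rewrite /D; case: ifP => // _; case: ifP.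
have [_ _ _ /(_ A QA)] := indep D (fun k w => fine (QR w (D k))) mD
  (fun k => XQ k _ (mD k)).
have Di : D i = B by rewrite /D eqxx.
have Dj : D j = C by rewrite /D eq_sym (negbTE ij) eqxx.
have -> : \bigcap_(k in [set: 'I_n]) X k @^-1` D k = X i @^-1` B `&` X j @^-1` C.
  apply/seteqP; split => w.
    by move=> h; split; [have := h i I|have := h j I]; rewrite /= ?Di ?Dj.
  move=> -[wB wC] k _; rewrite /= /D.
  by case: eqVneq => [->//|_]; case: eqVneq => [->|].
have mXp k E : measurable E -> measurable (X k @^-1` E).
  by move=> mE; rewrite -[X in measurable X]setTI; exact: mX.
rewrite integral_indic; last 2 first.
- exact: sub.
- by apply: measurableI; exact: mXp.
move=> E; rewrite -setIA setIC -E.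
apply: eq_integral => w _; rewrite (bigD1 i)//= (bigD1 j) ?[j == i]eq_sym//=.
rewrite big1 ?mulr1; last first.
  move=> k /andP[ki kj]; rewrite /D (negbTE ki) (negbTE kj).
  by rewrite (probability_setT (QR w)).
by rewrite Di Dj EFinM !fineQ.
Qed.

End sampling_laws.

(** * Powers and the rate of convergence *)

Lemma cube_root_powR (R : realType) (c : R) : 0 <= c ->
  (c `^ (1 / 3)) ^+ 3 = c.
Proof.
move=> c0; rewrite -powR_mulrn ?powR_ge0// -powRrM.
by rewrite div1r mulVf// powRr1.
Qed.

Lemma powR32 (R : realType) (a : R) : 0 < a ->
  a `^ (3 / 2) = a * Num.sqrt a.
Proof.
move=> a0; rewrite (_ : 3 / 2 = 1 + 2^-1); last by field.
by rewrite powRD ?(gt_eqF a0) ?implybT// powRr1 ?powR12_sqrt// ltW.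
Qed.

(** With [r = B^(1/2)], the estimates [sqrt (1 + r^2) <= 1 + r] and
    [(1 + r^2) (1 + r) <= 2 (1 + r^3)] avoid the convexity of [x^(3/2)] at the
    cost of a larger constant. *)
Lemma rate_bound (R : rcfType) (N n M r : R) :
  0 <= N -> 0 < n -> 0 <= M -> 0 <= r -> r ^+ 3 = 2 * (Num.sqrt n * Num.sqrt M) ->
  N * (Num.sqrt n)^-1 * ((1 + r ^+ 2) * Num.sqrt (1 + r ^+ 2)) <=
  4 * N * ((Num.sqrt n)^-1 + Num.sqrt M).
Proof.
move=> N0 n0 M0 r0 r3.
have sn0 : 0 < Num.sqrt n by rewrite sqrtr_gt0.
set s := Num.sqrt n in r3 sn0 *; set m := Num.sqrt M in r3 *.
have m0 : 0 <= m by exact: sqrtr_ge0.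
have r2 : 0 <= 1 + r ^+ 2 by rewrite addr_ge0// sqr_ge0.
have sq : Num.sqrt (1 + r ^+ 2) <= 1 + r.
  have := sqr_sqrtr r2; have := sqrtr_ge0 (1 + r ^+ 2); nra.
have cube : (1 + r ^+ 2) * Num.sqrt (1 + r ^+ 2) <= 2 * (1 + r ^+ 3).
  apply: (@le_trans _ _ ((1 + r ^+ 2) * (1 + r))); first exact: ler_wpM2l.
  have : 0 <= (1 + r) * (1 - r) ^+ 2 by rewrite mulr_ge0 ?sqr_ge0 ?addr_ge0.
  by nra.
have Ns : 0 <= N * s^-1 by rewrite mulr_ge0// invr_ge0 ltW.
apply: (le_trans (ler_wpM2l Ns cube)); rewrite r3.
rewrite [leLHS](_ : _ = N * (2 * s^-1 + 4 * m)); last by field; rewrite gt_eqF.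
rewrite [4 * N]mulrC -mulrA ler_wpM2l//.
have : 0 < s^-1 by rewrite invr_gt0.
by lra.
Qed.

(** * Error of importance sampling with an estimated proposal *)

Theorem theorem4p3 (R : realType) (dim : nat)
  (dO : measure_display) (Omega : measurableType dO) (Pr : probability Omega R)
  (P : probability (dim.-tuple R) R) (p f : dim.-tuple R -> R)
  (p_gt0 : forall x, 0 < p x)
  (p_density : has_density (lebesgue_tuple dim) P p)
  (f_L2 : f \in Lfun P 2%:E) :
  exists C : R, forall (F : set (set Omega))
    (Q : Omega -> pprobability (dim.-tuple R) R) (q : Omega -> dim.-tuple R -> R)
    (n : nat) (X : 'I_n -> {RV Pr >-> dim.-tuple R})
    (Z : {RV Pr >-> dim.-tuple R}),
  sigma_algebra [set: Omega] F ->
  F `<=` measurable ->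
  random_proposal Pr P F Q q ->
  (0 < n)%N ->
  (forall i, cond_law_is Pr (sigma_of Q) (X i)
               (fun w => (Q w : probability (dim.-tuple R) R))) ->
  cond_independent Pr (sigma_of Q) (fun i => X i : Omega -> dim.-tuple R) ->
  (forall B, measurable B -> distribution Pr Z B = P B) ->
  independent_of Pr F Z ->
  let I := target_integral p f in
  let In := importance_estimator p f q (fun i => X i : Omega -> dim.-tuple R) in
  let rho := importance_weight p q in
  let norm_f := 'N[P]_2%:E[EFin \o f]%E in
  let bound := (norm_f * ((Num.sqrt n%:R)^-1)%:E *
    (1 + ((4 * n%:R)%:E * MIAE Pr p q) `^ (1 / 3)) `^ (3 / 2))%E in
  [/\ cond_expectation_is Pr (sigma_of Q) In (cst I),
      ('E_Pr[In] = I%:E)%E,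
      ('V_Pr[In] <= (n%:R^-1)%:E * ('V_Pr[f \o Z] +
         \int[lebesgue_tuple dim]_x
           ('E_Pr[fun w => (`|rho w x - 1|)%R] * (f x ^+ 2 * p x)%:E)))%E,
      ('E_Pr[fun w => (`|In w - I|)%R] <= bound)%E &
      (bound <= C%:E * (((Num.sqrt n%:R)^-1)%:E + MIAE Pr p q `^ (1 / 2)))%E].
Proof.
move=> /=.
have [mp p0 PE] := p_density.
have [N N0 [NE N2]] := Lfun2_norm f_L2.
have f_int : P.-integrable [set: dim.-tuple R] (EFin \o f).
  apply/Lfun1_integrable; apply: Lfun_subset12 f_L2.
  by rewrite fin_num_measure.
have mf : measurable_fun [set: dim.-tuple R] f.
  by apply/measurable_EFinP; exact: measurable_int f_int.
exists (4 * N) => F Q q n X Z FS Fm [QF mq qQ PQ] n0 XQ indep ZP _.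
set I := target_integral p f.
set In := importance_estimator p f q (fun i => X i : Omega -> dim.-tuple R).
have sub : sigma_of Q `<=` measurable by exact: subset_trans QF Fm.
(* The space of conditioning is the sample space itself, with the sigma-algebra
   generated by the proposal. *)
pose S := g_sigma_algebraType (sigma_of Q).
pose Y : Omega -> S := id.
pose K : S -> pprobability (dim.-tuple R) R := Q.
pose q' (z : S * dim.-tuple R) := q z.1 z.2.
have mY : measurable_fun [set: Omega] Y := measurable_to_sigma_of sub.
have mK : measurable_fun [set: S] K := @measurable_proposal _ _ _ _ _ Q.
have mX i : measurable_fun [set: Omega] (X i) by exact: measurable_funPT.
have law1 i (A : set S) B : measurable A -> measurable B ->
    Pr (Y @^-1` A `&` X i @^-1` B) =
    (\int[Pr]_(w in Y @^-1` A) K (Y w) B)%E.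
  move=> /measurable_sigma_of QA mB.
  exact: (conditional_law_rectangle sub mX (XQ i) QA mB).
have law2 i j (A : set S) B C : i != j ->
    measurable A -> measurable B -> measurable C ->
    Pr (Y @^-1` A `&` X i @^-1` B `&` X j @^-1` C) =
    (\int[Pr]_(w in Y @^-1` A) (K (Y w) B * K (Y w) C))%E.
  move=> ij /measurable_sigma_of QA mB mC.
  exact: (conditional_law_pair sub mX ij XQ indep QA mB mC).
have IE : I = fine (\int[P]_x (f x)%:E)%E.
  by rewrite /I /target_integral /Rintegral (integral_density_signed p_density).
have mfs : measurable_fun [set: S * dim.-tuple R] (f \o snd).
  exact: (measurableT_comp mf measurable_snd).
have hf (z : S * dim.-tuple R) : `|(f \o snd) z| <= `|f z.2| by [].
have In_int : Pr.-integrable [set: Omega] (EFin \o In).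
  exact: (average_integrable mY mK mq p_gt0 p_density qQ PQ f_int mX law1
    mfs hf).
have condI : cond_expectation_is Pr (sigma_of Q) In (cst I).
  split => //.
  - exact: finite_measure_integrable_cst.
  - move=> _ [B mB <-]; apply/measurable_sigma_of.
    exact: (@measurable_cst _ _ S).
  - move=> A QA; apply/esym.
    rewrite IE.
    apply: (average_conditional_mean mY mK mq p_gt0 p_density qQ PQ f_int mX
      law1 mfs hf n0 (A := A)).
    exact/measurable_sigma_of.
have EIn : ('E_Pr[In] = I%:E)%E.
  have [_ _ _ /(_ [set: Omega])] := condI.
  rewrite unlock => <-.
    transitivity (\int[Pr]_w I%:E)%E => //.
    by rewrite integral_cst//= probability_setT mule1.
  by exists setT => //; rewrite preimage_setT setTI.
pose M := fine (MIAE Pr p q).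
have ME : MIAE Pr p q = M%:E.
  rewrite fineK// ge0_fin_numE.
    apply: (le_lt_trans (mean_abs_error_le2 mY mq p_gt0 p_density qQ)).
    exact: ltry.
  by apply: integral_ge0 => w _; apply: integral_ge0 => x _; rewrite lee_fin.
have M0 : 0 <= M.
  rewrite -lee_fin -ME.
  by apply: integral_ge0 => w _; apply: integral_ge0 => x _; rewrite lee_fin.
pose c : R := 4 * n%:R * M; pose B := c `^ (1 / 3).
have c0 : 0 <= c by rewrite !mulr_ge0.
have B0 : 0 <= B by exact: powR_ge0.
have B3 : B ^+ 3 = c by exact: cube_root_powR.
have boundE : ('N[P]_2%:E[EFin \o f] * ((Num.sqrt n%:R)^-1)%:E *
    (1 + ((4 * n%:R)%:E * MIAE Pr p q) `^ (1 / 3)) `^ (3 / 2) =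
    (N * (Num.sqrt n%:R)^-1 * ((1 + B) * Num.sqrt (1 + B)))%:E)%E.
  by rewrite NE ME -!EFinM -/c -/B powR32// ltr_wpDr.
split => //.
- have ZE (g : dim.-tuple R -> \bar R) : measurable_fun [set: dim.-tuple R] g ->
      (forall x, 0 <= g x)%E -> (\int[Pr]_w g (Z w) = \int[P]_x g x)%E.
    move=> mg g0; rewrite -(ge0_integral_distribution Z mg g0).
    by apply: eq_measure_integral => A mA _; exact: ZP.
  have EfZ : ('E_Pr[f \o Z] = I%:E)%E.
    rewrite unlock IE fineK; last exact: (integrable_fin_num measurableT f_int).
    have mEf : measurable_fun [set: dim.-tuple R] (EFin \o f).
      exact/measurable_EFinP.
    rewrite integralE [RHS]integralE -!ZE//; try exact: measurable_funepos;
      try exact: measurable_funeneg.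
    by congr (_ - _)%E; apply: eq_integral => w _; rewrite ?funeposE ?funenegE.
  have VfZ : ('V_Pr[f \o Z] = (N ^+ 2 - I ^+ 2)%:E)%E.
    rewrite /variance covariance.unlock EfZ /= expectation.unlock.
    transitivity (\int[P]_x ((f x - I) ^+ 2)%:E)%E.
      rewrite -(ZE (fun x => ((f x - I) ^+ 2)%:E)) //.
      - by apply/measurable_EFinP; apply: measurable_funX; exact: measurable_funB.
      - by move=> x; rewrite lee_fin sqr_ge0.
    rewrite IE; apply: integral_sqr_centered => //.
    exact: Lfun2_integrable_sqr f_L2.
  have -> : ('V_Pr[In] = \int[Pr]_w ((In w - I) ^+ 2)%:E)%E.
    by rewrite /variance covariance.unlock EIn /= expectation.unlock.
  rewrite VfZ [X in (_ <= _ * (_ + X))%E](_ : _ = (\int[Pr]_w \int[P]_x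
      (`|p x / q w x - 1| * f x ^+ 2)%:E)%E); last first.
    rewrite -(weighted_error_swap Pr mY mq p_density f_int).
    by apply: eq_integral => x _; rewrite unlock.
  rewrite IE.
  exact: (variance_bound mY mK mq p_gt0 p_density qQ PQ f_int mX law1 law2
    N2 n0).
- rewrite boundE unlock IE.
  exact: (mean_abs_deviation mY mK mq p_gt0 p_density qQ PQ f_int mX law1 law2
    N0 N2 n0 ME B0 B3).
- rewrite boundE ME -EFinM lee_fin [1 / 2]div1r powR12_sqrt//.
  have r2 : Num.sqrt B ^+ 2 = B by rewrite sqr_sqrtr.
  rewrite -r2; apply: rate_bound => //; rewrite ?ltr0n ?sqrtr_ge0//.
  apply/eqP; rewrite -(eqrXn2 (n := 2)) ?mulr_ge0 ?exprn_ge0 ?sqrtr_ge0//.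
  rewrite -exprM mulnC exprM r2 B3 /c !exprMn !sqr_sqrtr//.
  by apply/eqP; ring.
Qed.
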